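(* Let $p>q>0$ be integers, and let $a\in\mathbb{C}$ be a Misiurewicz point for the family $\mathbf{f}_c(z)=\sqrt[q]{z^p}+c$. For every parameter $c$ in a neighborhood of $a$, the filled Julia set $K_c$ is asymptotically $\lambda(c)$-self-similar about each point $z_j(c)$, $j\ge 0$, of the orbit $$\xi(c)=z_0(c)\to z_1(c)\to\cdots\to z_\ell(c)\to\cdots\to z_{\ell+n}(c)=z_\ell(c)$$ of $\mathbf{f}_c$ obtained by holomorphic continuation in $c$ of the bounded forward orbit of $a$ under $\mathbf{f}_a$, where $\lambda(c)$ is the multiplier of the repelling cycle starting at $z_\ell(c)$.
   Context: **The correspondence.** For $c\in\mathbb{C}$, $\mathbf{f}_c$ is the multivalued map with $w\in\mathbf{f}_c(z)$ iff $(w-c)^q=z^p$. A forward orbit of $z_0$ under $\mathbf{f}_c$ is a sequence $(z_j)_{j\ge0}$ with $z_{j+1}\in\mathbf{f}_c(z_j)$ for all $j$; it is bounded if it is contained in a compact subset of $\mathbb{C}$. The filled Julia set $K_c$ is the set of all $z\in\mathbb{C}$ having at least one bounded forward orbit under $\mathbf{f}_c$. A parameter $a\in\mathbb{C}$ is a Misiurewicz point if the critical point $0$ has a unique bounded forward orbit under $\mathbf{f}_a$ and this orbit is strictly pre-periodic (eventually periodic but not periodic). A univalent branch of $\mathbf{f}_c$ is an injective holomorphic map $f$ with $f(z)\in\mathbf{f}_c(z)$ for all $z$ in its domain. **Setting near a Misiurewicz point $a$.** The point $a$ has a unique bounded forward orbit $z_0=a,z_1,z_2,\dots$ under $\mathbf{f}_a$;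 it is pre-periodic and no $z_j$ equals $0$. Let $\ell$ be the smallest index such that $z_\ell$ lies on the cycle of this orbit (one has $\ell\ge1$) and $n$ the period, so $z_{j+n}=z_j$ for $j\ge\ell$. For $j\ge1$, $f_j$ is the univalent branch of $\mathbf{f}_a$ defined near $z_{j-1}$ with $f_j(z_{j-1})=z_j$, and $f_{j,c}=f_j+(c-a)$ is the corresponding perturbed branch of $\mathbf{f}_c$. Put $g_c=f_{\ell,c}\circ\cdots\circ f_{1,c}$ (near $a$) and $h_c=f_{\ell+n,c}\circ\cdots\circ f_{\ell+1,c}$ (near $z_\ell$). The cycle is known to be repelling: $|h_a'(z_\ell)|>1$. For $c$ near $a$, $z_\ell(c)$ denotes the fixed point of $h_c$ depending holomorphically on $c$ with $z_\ell(a)=z_\ell$; $\xi(c)$ is the unique point near $a$ with $g_c(\xi(c))=z_\ell(c)$ (holomorphic in $c$, $\xi(a)=a$); $z_0(c)=\xi(c)$ and $z_j(c)=f_{j,c}(z_{j-1}(c))$ for $j\ge1$, so that $z_{j+n}(c)=z_j(c)$ for $j\ge\ell$. The multiplier is $\lambda(c)=h_c'(z_\ell(c))$, with $|\lambda(c)|>1$ for $c$ near $a$. **Self-similarity.** For a closed nonempty $A\subset\mathbb{C}$ and $r>0$, let $A_r=(A\cap\overline{\mathbb{D}}_r)\cup\partial\mathbb{D}_r$, where $\mathbb{D}_r=\{|z|<r\}$, and let $T_{-x}A=\{z-x:z\in A\}$. For $\lambda\in\mathbb{C}$ with $|\lambda|>1$, $A$ is asymptotically $\lambda$-self-similar about $x\in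 A$ with limit model $B$ (a nonempty closed subset of $\mathbb{C}$) if, for some $r>0$, $(\lambda^kT_{-x}A)_r\to B_r$ as $k\to\infty$ in the Hausdorff distance. It is asymptotically $\lambda$-self-similar about $x$ if this holds for some limit model $B$. *)

(* Defs.v *)
From Stdlib Require Import Reals List.
From Coquelicot Require Import Coquelicot.

Open Scope C_scope.

(** ** Subsets of the plane *)

Definition compact_set (K : C -> Prop) : Prop :=
  forall (I : Type) (U : I -> C -> Prop),
    (forall i, open (U i)) ->
    (forall z, K z -> exists i, U i z) ->
    exists s : list I, forall z, K z -> exists i, In i s /\ U i z.

Definition nonempty (A : C -> Prop) : Prop := exists z, A z.

Definition translate_to_0 (x : C) (A : C -> Prop) : C -> Prop :=
  fun w => exists z, A z /\ w = z - x.

Definition dilate (m : C) (A : C -> Prop) : C -> Prop :=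
  fun w => exists z, A z /\ w = m * z.

(** [A_r], the trace of [A] on the closed disc of radius [r], together with
    the boundary circle. *)
Definition truncate (r : R) (A : C -> Prop) : C -> Prop :=
  fun w => (A w /\ (Cmod w <= r)%R) \/ Cmod w = r.

Definition in_thickening (e : R) (X Y : C -> Prop) : Prop :=
  forall x, X x -> exists y, Y y /\ (Cmod (x - y) <= e)%R.

Definition hausdorff_dist (X Y : C -> Prop) : Rbar :=
  Glb_Rbar (fun e => (0 <= e)%R /\ in_thickening e X Y /\ in_thickening e Y X).

Definition hausdorff_cvg (X : nat -> C -> Prop) (Y : C -> Prop) : Prop :=
  forall eps : R, (0 < eps)%R ->
    exists N : nat, forall k : nat, (N <= k)%nat ->
      Rbar_lt (hausdorff_dist (X k) Y) eps.

Definition self_similar_with_model (lam : C) (A : C -> Prop) (x : C)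
    (B : C -> Prop) : Prop :=
  exists r : R, (0 < r)%R /\
    hausdorff_cvg
      (fun k => truncate r (dilate (lam ^ k) (translate_to_0 x A)))
      (truncate r B).

(** The standing requirements of the notion ([|lam| > 1], [A] closed, [x] in
    [A]) are part of the predicate. *)
Definition asymptotically_self_similar (lam : C) (A : C -> Prop) (x : C)
    : Prop :=
  (1 < Cmod lam)%R /\ closed A /\ A x /\
  exists B : C -> Prop,
    closed B /\ nonempty B /\ self_similar_with_model lam A x B.

(** ** The correspondence [(w - c)^q = z^p] *)

Definition corr (p q : nat) (c z w : C) : Prop := (w - c) ^ q = z ^ p.

Definition bounded_seq (z : nat -> C) : Prop :=
  exists K : C -> Prop, compact_set K /\ forall j, K (z j).

Definition bounded_forward_orbit (p q : nat) (c z0 : C) (z : nat -> C)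
    : Prop :=
  z 0%nat = z0 /\ (forall j, corr p q c (z j) (z (S j))) /\ bounded_seq z.

Definition filled_julia (p q : nat) (c : C) : C -> Prop :=
  fun z0 => exists z, bounded_forward_orbit p q c z0 z.

Definition periodic_seq (z : nat -> C) : Prop :=
  exists m : nat, (0 < m)%nat /\ forall j, z (j + m)%nat = z j.

Definition eventually_periodic_seq (z : nat -> C) : Prop :=
  exists i m : nat,
    (0 < m)%nat /\ forall j, (i <= j)%nat -> z (j + m)%nat = z j.

Definition misiurewicz (p q : nat) (a : C) : Prop :=
  exists z : nat -> C,
    bounded_forward_orbit p q a 0 z /\
    (forall z', bounded_forward_orbit p q a 0 z' -> forall j, z' j = z j) /\
    eventually_periodic_seq z /\ ~ periodic_seq z.

(** [w] lies on the cycle into which the sequence [z] eventually falls. *)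
Definition on_cycle (z : nat -> C) (w : C) : Prop :=
  exists i m : nat,
    (0 < m)%nat /\ (forall j, (i <= j)%nat -> z (j + m)%nat = z j) /\
    exists k : nat, (i <= k)%nat /\ z k = w.

Definition first_cyclic_index (z : nat -> C) (l : nat) : Prop :=
  on_cycle z (z l) /\ forall i, (i < l)%nat -> ~ on_cycle z (z i).

Definition period_from (z : nat -> C) (l n : nat) : Prop :=
  (0 < n)%nat /\ (forall j, (l <= j)%nat -> z (j + n)%nat = z j) /\
  forall m : nat, (0 < m)%nat ->
    (forall j, (l <= j)%nat -> z (j + m)%nat = z j) -> (n <= m)%nat.

(** ** Univalent branches and their perturbations *)

Definition holomorphic_near (x : C) (f : C -> C) : Prop :=
  locally x (fun z => ex_derive (f : C -> C) z).

(** Branches are total functions, of which only the values on [D] matter. *)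
Definition univalent_branch (p q : nat) (c : C) (D : C -> Prop) (f : C -> C)
    : Prop :=
  open D /\
  (forall z, D z -> ex_derive (f : C -> C) z) /\
  (forall z w, D z -> D w -> f z = f w -> z = w) /\
  (forall z, D z -> corr p q c z (f z)).

Definition univalent_branch_near (p q : nat) (c x : C) (f : C -> C) : Prop :=
  exists D : C -> Prop, D x /\ univalent_branch p q c D f.

Definition perturb (a : C) (f : nat -> C -> C) (c : C) : nat -> C -> C :=
  fun j z => f j z + (c - a).

(** [compose_from F m k] is [F (m+k) o ... o F (m+1)]. *)
Fixpoint compose_from (F : nat -> C -> C) (m k : nat) (z : C) : C :=
  match k with
  | O => z
  | S k' => F (m + k)%nat (compose_from F m k' z)
  end.

(** [g_c], from near [a] to near [z_l]. *)
Definition transit_map (a : C) (f : nat -> C -> C) (l : nat) (c : C)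
    : C -> C :=
  compose_from (perturb a f c) 0 l.

(** [h_c], the return map near [z_l]. *)
Definition return_map (a : C) (f : nat -> C -> C) (l n : nat) (c : C)
    : C -> C :=
  compose_from (perturb a f c) l n.

(** [lambda(c)], where [zl] is the function [c |-> z_l(c)]. *)
Definition multiplier (a : C) (f : nat -> C -> C) (l n : nat) (zl : C -> C)
    (c : C) : C :=
  C_derive (return_map a f l n c) (zl c).

(** [z_j(c)], where [xi] is the function [c |-> z_0(c)]. *)
Definition continued_orbit (a : C) (f : nat -> C -> C) (xi : C -> C) (c : C)
    (j : nat) : C :=
  compose_from (perturb a f c) 0 j (xi c).

(* Main.v *)
(** The bounded orbit [z] of [a] is repelling by an extremal argument.  As [z] is
    the only bounded forward orbit of [a], a neighbourhood [U] of the filled Julia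
    set, stable with a margin under preimages, contains no other forward images
    of [a].  Holomorphic maps [phi] of the unit disc into [U] with [phi 0] on the
    cycle and no other value in the orbit can then be lifted along the
    correspondence (a [p]-th root of a zero-free function on a disc), which
    divides [phi'(0)] by the multiplier after one turn; the margin leaves room to
    compose with a map fixing the orbit and expanding at [phi 0].  Since Cauchy's
    estimate bounds [phi'(0)], the multiplier must exceed [1] in modulus.

    For [c] near [a] the same uniqueness, open by a compactness argument, shows
    that near [z_j(c)] a point lies in [K_c] iff its image under the branch
    [f_{j+1,c}] does.  Hence [K_c] is locally invariant under the return map and
    under the transit map from [z_j(c)] to the cycle, and Koenigs' linearization
    gives the limit model. *)

Require Import Defs.
From Stdlib Require Import Reals Lra Lia List ClassicalEpsilon Classical.
From Coquelicot Require Import Coquelicot.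

Local Open Scope R_scope.

(** * Strong differentiability *)

(** That the cycle repels is proved here, not assumed, and without a hyperbolic metric: composing
    with an expanding map replaces the strict Schwarz inequality. A lift of [phi] could branch only
    where [phi] takes the critical value [a]. Since [a] is itself on the orbit, a map that meets the
    orbit only at [0], in a point other than [a], has no such place, and uniqueness of the orbit
    passes the same avoidance on to the lift. Analysis enters through two-point derivatives with
    quadratic error: they are stable under products, composition and implicit equations, and away
    from [0] the algebraic relation gives them to every continuous branch. The only global fact
    about holomorphic functions is then Cauchy's estimate, obtained from finite circle sums.
    Compactness takes the form of one uniform gauge on a disc; for pseudo-orbits a single small
    number bounds the change of parameter, the error and the inverse of the length. *)

Lemma Cmod_sub_sym (x y : C) : Cmod (x - y) = Cmod (y - x).
Proof. rewrite <- Cmod_opp. f_equal. ring. Qed.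

Lemma Cmod_le_add (x y z : C) : x = (y + z)%C -> Cmod x <= Cmod y + Cmod z.
Proof. intros ->. apply Cmod_triangle. Qed.

Lemma Cmod_sub_triangle (y x z : C) : Cmod (x - z) <= Cmod (x - y) + Cmod (y - z).
Proof. apply Cmod_le_add. ring. Qed.

Lemma Cmod_sub_diag (x : C) : Cmod (x - x) = 0.
Proof. replace (x - x)%C with (RtoC 0) by ring. apply Cmod_0. Qed.

Lemma Cmod_sub_eq_0 (x y : C) : Cmod (x - y) <= 0 -> x = y.
Proof.
  intros H. assert (E : (x - y)%C = 0).
  { apply Cmod_eq_0. generalize (Cmod_ge_0 (x - y)). lra. }
  replace x with ((x - y) + y)%C by ring. rewrite E. ring.
Qed.

Lemma Cmod_sub_pos (x y : C) : x <> y -> 0 < Cmod (x - y).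
Proof.
  intros H. destruct (Rle_lt_dec (Cmod (x - y)) 0) as [h|h]; auto.
  now apply Cmod_sub_eq_0 in h.
Qed.

Lemma Cmod_sub_le (x y : C) : Cmod (x - y) <= Cmod x + Cmod y.
Proof. rewrite <- (Cmod_opp y). apply Cmod_le_add. ring. Qed.

Lemma Cmod_le_sub (x y : C) : Cmod x <= Cmod y + Cmod (x - y).
Proof. apply Cmod_le_add. ring. Qed.

Lemma Cmult_integral_l (x y : C) : x <> 0%C -> (x * y = 0)%C -> y = 0%C.
Proof.
  intros H E. replace y with (/ x * (x * y))%C by (field; auto).
  rewrite E. ring.
Qed.

Lemma Cpow_eq_0 (x : C) (k : nat) : (x ^ k = 0)%C -> x = 0%C.
Proof.
  intros H. destruct (Ceq_dec x 0) as [|n]; auto. now apply Cpow_nz with (n := k) in n.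
Qed.

Lemma Cpow_0_l (k : nat) : (0 < k)%nat -> (0 ^ k = 0)%C.
Proof. destruct k; [lia|]. intros _. simpl. ring. Qed.

Lemma locally_Cmod (x : C) (P : C -> Prop) :
  @locally C_UniformSpace x P <-> exists d, 0 < d /\ forall y, Cmod (y - x) < d -> P y.
Proof.
  split.
  - intros [d H]. exists d. split; [apply cond_pos|].
    intros y Hy. apply H. now apply C_NormedModule_mixin_compat1.
  - intros [d [Hd H]].
    assert (0 < sqrt 2) by (apply sqrt_lt_R0; lra).
    assert (He : 0 < d / sqrt 2) by (apply Rdiv_lt_0_compat; lra).
    exists (mkposreal _ He). intros y Hy. apply H.
    apply C_NormedModule_mixin_compat2 in Hy. simpl in Hy.
    replace d with (sqrt 2 * (d / sqrt 2)) by (field; lra). exact Hy.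
Qed.

Definition cont_at (f : C -> C) (x : C) : Prop :=
  forall e, 0 < e -> exists d, 0 < d /\ forall y, Cmod (y - x) < d -> Cmod (f y - f x) < e.

Lemma cont_at_ex_derive (f : C -> C) (x : C) :
  @ex_derive C_AbsRing C_NormedModule f x -> cont_at f x.
Proof.
  intros H e He. apply ex_derive_continuous in H.
  specialize (H (fun w => Cmod (w - f x) < e)).
  apply (locally_Cmod x (fun y => Cmod (f y - f x) < e)).
  apply locally_C. apply H.
  apply locally_Cmod. exists e. auto.
Qed.

(** Differentiability in a strong two-point form with quadratic error, which is
    stable under composition and inversion. *)
Definition sderiv (f : C -> C) (x al : C) : Prop :=
  exists M d, 0 <= M /\ 0 < d /\
    forall y y', Cmod (y - x) < d -> Cmod (y' - x) < d ->
      Cmod (f y - f y' - al * (y - y'))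
        <= M * (Cmod (y - x) + Cmod (y' - x)) * Cmod (y - y').

Lemma sderiv_data (f : C -> C) (x al : C) :
  sderiv f x al ->
  exists M d L, 0 <= M /\ 0 < d /\ 0 <= L /\
    (forall y y', Cmod (y - x) < d -> Cmod (y' - x) < d ->
      Cmod (f y - f y' - al * (y - y'))
        <= M * (Cmod (y - x) + Cmod (y' - x)) * Cmod (y - y')) /\
    (forall y y', Cmod (y - x) < d -> Cmod (y' - x) < d ->
      Cmod (f y - f y') <= L * Cmod (y - y')).
Proof.
  intros [M [d [HM [Hd H]]]].
  exists M, d, (Cmod al + M * (d + d)).
  assert (0 <= M * (d + d)) by (apply Rmult_le_pos; lra).
  generalize (Cmod_ge_0 al). intros Ha.
  repeat split; auto; try lra.
  intros y y' Hy Hy'. specialize (H y y' Hy Hy').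
  assert (E : Cmod (f y - f y') <= Cmod (al * (y - y')) + Cmod (f y - f y' - al * (y - y')))
    by (apply Cmod_le_sub).
  rewrite Cmod_mult in E.
  assert (M * (Cmod (y - x) + Cmod (y' - x)) * Cmod (y - y') <= M * (d + d) * Cmod (y - y')).
  { apply Rmult_le_compat_r; [apply Cmod_ge_0|]. apply Rmult_le_compat_l; lra. }
  lra.
Qed.

Lemma sderiv_cont (f : C -> C) (x al : C) : sderiv f x al -> cont_at f x.
Proof.
  intros H e He. destruct (sderiv_data _ _ _ H) as [M [d [L [HM [Hd [HL [_ HLip]]]]]]].
  assert (0 < e / (L + 1)) by (apply Rdiv_lt_0_compat; lra).
  exists (Rmin d (e / (L + 1))). split; [apply Rmin_pos; auto|].
  intros y Hy.
  assert (Cmod (y - x) < d) by (eapply Rlt_le_trans; [apply Hy|apply Rmin_l]).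
  assert (Cmod (y - x) < e / (L + 1)) by (eapply Rlt_le_trans; [apply Hy|apply Rmin_r]).
  specialize (HLip y x). rewrite Cmod_sub_diag in HLip.
  assert (E : (L + 1) * (e / (L + 1)) = e) by (field; lra).
  assert (L * Cmod (y - x) <= L * (e / (L + 1))) by (apply Rmult_le_compat_l; lra).
  assert (Cmod (f y - f x) <= L * Cmod (y - x)) by (apply HLip; auto).
  lra.
Qed.

Lemma sderiv_near_ext (f g : C -> C) (x al : C) (r : R) :
  0 < r -> (forall y, Cmod (y - x) < r -> f y = g y) -> sderiv f x al -> sderiv g x al.
Proof.
  intros Hr E [M [d [HM [Hd H]]]].
  exists M, (Rmin d r). split; [auto|]. split; [apply Rmin_pos; auto|].
  intros y y' Hy Hy'.
  generalize (Rmin_l d r) (Rmin_r d r). intros.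
  rewrite <- (E y), <- (E y') by lra. apply H; lra.
Qed.

Lemma sderiv_affine (al be x : C) : sderiv (fun w => al * w + be)%C x al.
Proof.
  exists 0, 1. split; [lra|]. split; [lra|]. intros y y' _ _.
  replace (al * y + be - (al * y' + be) - al * (y - y'))%C with (RtoC 0) by ring.
  rewrite Cmod_0. lra.
Qed.

Lemma sderiv_id (x : C) : sderiv (fun w => w) x 1.
Proof.
  apply (sderiv_near_ext (fun w => 1 * w + 0)%C _ _ _ 1).
  - lra.
  - intros. ring.
  - apply sderiv_affine.
Qed.

Lemma sderiv_const (c x : C) : sderiv (fun _ => c) x 0.
Proof.
  apply (sderiv_near_ext (fun w => 0 * w + c)%C _ _ _ 1).
  - lra.
  - intros. ring.
  - apply sderiv_affine.
Qed.

Lemma sderiv_plus (f g : C -> C) (x al be : C) :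
  sderiv f x al -> sderiv g x be -> sderiv (fun w => f w + g w)%C x (al + be).
Proof.
  intros [M [d [HM [Hd H]]]] [M' [d' [HM' [Hd' H']]]].
  exists (M + M'), (Rmin d d'). split; [lra|]. split; [apply Rmin_pos; auto|].
  generalize (Rmin_l d d') (Rmin_r d d'). intros Hl Hr y y' Hy Hy'.
  specialize (H y y' ltac:(lra) ltac:(lra)). specialize (H' y y' ltac:(lra) ltac:(lra)).
  eapply Rle_trans.
  - apply (Cmod_le_add _ (f y - f y' - al * (y - y')) (g y - g y' - be * (y - y'))). ring.
  - nra.
Qed.

Lemma sderiv_comp (f g : C -> C) (x al be : C) :
  sderiv f x al -> sderiv g (f x) be -> sderiv (fun w => g (f w)) x (be * al).
Proof.
  intros Hf [M' [d' [HM' [Hd' H']]]].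
  destruct (sderiv_cont _ _ _ Hf d' Hd') as [d0 [Hd0 Hc]].
  destruct (sderiv_data _ _ _ Hf) as [M [d [L [HM [Hd [HL [HQ HLip]]]]]]].
  generalize (Cmod_ge_0 be). intros Hbe.
  exists (M' * L * L + Cmod be * M), (Rmin d d0).
  split. { repeat apply Rplus_le_le_0_compat; repeat apply Rmult_le_pos; auto. }
  split; [apply Rmin_pos; auto|].
  generalize (Rmin_l d d0) (Rmin_r d d0). intros Hl Hr y y' Hy Hy'.
  specialize (H' (f y) (f y') (Hc y ltac:(lra)) (Hc y' ltac:(lra))).
  assert (L1 := HLip y x ltac:(lra) ltac:(rewrite Cmod_sub_diag; lra)).
  assert (L2 := HLip y' x ltac:(lra) ltac:(rewrite Cmod_sub_diag; lra)).
  assert (L3 := HLip y y' ltac:(lra) ltac:(lra)).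
  specialize (HQ y y' ltac:(lra) ltac:(lra)).
  eapply Rle_trans.
  - apply (Cmod_le_add _ (g (f y) - g (f y') - be * (f y - f y'))
             (be * (f y - f y' - al * (y - y')))). ring.
  - rewrite Cmod_mult.
    set (s := Cmod (y - x) + Cmod (y' - x)) in *. set (h := Cmod (y - y')) in *.
    assert (0 <= s) by (unfold s; generalize (Cmod_ge_0 (y - x)) (Cmod_ge_0 (y' - x)); lra).
    assert (0 <= h) by apply Cmod_ge_0.
    assert (Cmod be * Cmod (f y - f y' - al * (y - y')) <= Cmod be * (M * s * h))
      by (apply Rmult_le_compat_l; auto).
    assert (M' * (Cmod (f y - f x) + Cmod (f y' - f x)) * Cmod (f y - f y')
            <= M' * (L * s) * (L * h)).
    { apply Rmult_le_compat; auto; try apply Cmod_ge_0.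
      - apply Rmult_le_pos; auto.
        generalize (Cmod_ge_0 (f y - f x)) (Cmod_ge_0 (f y' - f x)); lra.
      - apply Rmult_le_compat_l; auto. unfold s. lra. }
    nra.
Qed.

Lemma sderiv_mult (f g : C -> C) (x al be : C) :
  sderiv f x al -> sderiv g x be ->
  sderiv (fun w => f w * g w)%C x (al * g x + f x * be).
Proof.
  intros Hf Hg.
  destruct (sderiv_data _ _ _ Hf) as [M [d [L [HM [Hd [HL [HQ HLip]]]]]]].
  destruct (sderiv_data _ _ _ Hg) as [M' [d' [L' [HM' [Hd' [HL' [HQ' HLip']]]]]]].
  set (F := Cmod (f x) + L * d). set (G := Cmod (g x) + L' * d').
  assert (HF : 0 <= F) by (unfold F; generalize (Cmod_ge_0 (f x)); nra).
  assert (HG : 0 <= G) by (unfold G; generalize (Cmod_ge_0 (g x)); nra).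
  generalize (Cmod_ge_0 al) (Cmod_ge_0 be). intros Hal Hbe.
  exists (M * G + Cmod al * L' + F * M' + Cmod be * L), (Rmin d d').
  split. { repeat apply Rplus_le_le_0_compat; repeat apply Rmult_le_pos; auto. }
  split; [apply Rmin_pos; auto|].
  generalize (Rmin_l d d') (Rmin_r d d'). intros Hl Hr y y' Hy Hy'.
  assert (A1 := HLip' y x ltac:(lra) ltac:(rewrite Cmod_sub_diag; lra)).
  assert (A2 := HLip y' x ltac:(lra) ltac:(rewrite Cmod_sub_diag; lra)).
  specialize (HQ y y' ltac:(lra) ltac:(lra)).
  specialize (HQ' y y' ltac:(lra) ltac:(lra)).
  assert (GY : Cmod (g y) <= G).
  { unfold G. eapply Rle_trans; [apply (Cmod_le_sub _ (g x))|].
    apply Rplus_le_compat_l. eapply Rle_trans; [apply A1|]. apply Rmult_le_compat_l; lra. }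
  assert (FY : Cmod (f y') <= F).
  { unfold F. eapply Rle_trans; [apply (Cmod_le_sub _ (f x))|].
    apply Rplus_le_compat_l. eapply Rle_trans; [apply A2|]. apply Rmult_le_compat_l; lra. }
  eapply Rle_trans.
  - apply (Cmod_le_add _ ((f y - f y' - al * (y - y')) * g y + al * (y - y') * (g y - g x))
             (f y' * (g y - g y' - be * (y - y')) + be * (y - y') * (f y' - f x))). ring.
  - eapply Rle_trans; [apply Rplus_le_compat; apply Cmod_triangle|].
    rewrite !Cmod_mult.
    set (a := Cmod (y - x)) in *. set (b := Cmod (y' - x)) in *. set (h := Cmod (y - y')) in *.
    assert (0 <= a) by apply Cmod_ge_0. assert (0 <= b) by apply Cmod_ge_0.
    assert (0 <= h) by apply Cmod_ge_0.
    assert (Cmod (f y - f y' - al * (y - y')) * Cmod (g y) <= (M * (a + b) * h) * G)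
      by (apply Rmult_le_compat; auto; apply Cmod_ge_0).
    assert (Cmod (f y') * Cmod (g y - g y' - be * (y - y')) <= F * (M' * (a + b) * h))
      by (apply Rmult_le_compat; auto; apply Cmod_ge_0).
    assert (Cmod al * h * Cmod (g y - g x) <= Cmod al * h * (L' * (a + b))).
    { apply Rmult_le_compat_l; [apply Rmult_le_pos; auto|]. nra. }
    assert (Cmod be * h * Cmod (f y' - f x) <= Cmod be * h * (L * (a + b))).
    { apply Rmult_le_compat_l; [apply Rmult_le_pos; auto|]. nra. }
    nra.
Qed.

Lemma sderiv_pow (k : nat) (x : C) :
  sderiv (fun w => w ^ k)%C x (INR k * x ^ (k - 1)).
Proof.
  induction k as [|k IH].
  - simpl. replace (0 * 1)%C with (RtoC 0) by ring. apply sderiv_const.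
  - assert (E := sderiv_mult _ _ _ _ _ (sderiv_id x) IH).
    apply (sderiv_near_ext _ (fun w => w ^ S k)%C _ _ 1) in E; [|lra|reflexivity].
    replace (INR (S k) * x ^ (S k - 1))%C with (1 * x ^ k + x * (INR k * x ^ (k - 1)))%C; auto.
    rewrite S_INR, RtoC_plus. replace (S k - 1)%nat with k by lia.
    destruct k; [simpl; ring|]. replace (S k - 1)%nat with k by lia. rewrite (Cpow_S x k). ring.
Qed.

Lemma sderiv_inv (x : C) : x <> 0%C -> exists al, sderiv Cinv x al.
Proof.
  intros Hx. exists (- / (x * x))%C.
  assert (Hm : 0 < Cmod x) by now apply Cmod_gt_0.
  set (m := Cmod x) in *.
  (* On this disc [m / 2 <= Cmod y], so the numerator of the difference is at most [2 * Cmod y']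
     times the sum of the distances to [x]. Dividing by [m * m * Cmod y * Cmod y'] leaves at most
     [4 / m ^ 3]; [8] is generous. *)
  exists (8 / (m * m * m)), (m / 2).
  assert (0 < m * m * m) by (repeat apply Rmult_lt_0_compat; auto).
  split; [apply Rlt_le, Rdiv_lt_0_compat; lra|]. split; [lra|].
  intros y y' Hy Hy'.
  assert (Hb : forall u, Cmod (u - x) < m / 2 -> m / 2 <= Cmod u).
  { intros u Hu. assert (E := Cmod_le_sub x u). rewrite Cmod_sub_sym in E. fold m in E. lra. }
  assert (By := Hb _ Hy). assert (By' := Hb _ Hy').
  assert (y <> 0)%C by (apply Cmod_gt_0; lra).
  assert (y' <> 0)%C by (apply Cmod_gt_0; lra).
  replace (/ y - / y' - - / (x * x) * (y - y'))%C
    with ((y - y') * (((y - x) * y' + x * (y' - x)) / ((x * x) * (y * y'))))%C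
    by (field; repeat split; auto).
  rewrite Cmod_mult, Cmod_div by (repeat apply Cmult_neq_0; auto).
  rewrite !Cmod_mult. fold m.
  rewrite (Rmult_comm (Cmod (y - y'))).
  apply Rmult_le_compat_r; [apply Cmod_ge_0|].
  assert (N : Cmod ((y - x) * y' + x * (y' - x)) <= (Cmod (y - x) + Cmod (y' - x)) * (2 * Cmod y')).
  { eapply Rle_trans; [apply Cmod_triangle|]. rewrite !Cmod_mult. fold m.
    generalize (Cmod_ge_0 (y - x)) (Cmod_ge_0 (y' - x)). nra. }
  set (s := Cmod (y - x) + Cmod (y' - x)) in *.
  assert (0 <= s) by (unfold s; generalize (Cmod_ge_0 (y - x)) (Cmod_ge_0 (y' - x)); lra).
  set (u := Cmod y) in *. set (v := Cmod y') in *.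
  assert (0 < m * m * (u * v)) by (repeat apply Rmult_lt_0_compat; lra).
  apply Rle_div_l; auto.
  eapply Rle_trans; [apply N|].
  replace (8 / (m * m * m) * s * (m * m * (u * v))) with (s * (8 * u * v / m)) by (field; lra).
  apply Rmult_le_compat_l; auto. apply (Rle_div_r (2 * v) (8 * u * v) m); auto. nra.
Qed.

Lemma sderiv_lower (f : C -> C) (x al : C) :
  sderiv f x al -> al <> 0%C ->
  exists d, 0 < d /\ forall y y', Cmod (y - x) < d -> Cmod (y' - x) < d ->
    Cmod al / 2 * Cmod (y - y') <= Cmod (f y - f y').
Proof.
  intros [M [d [HM [Hd H]]]] Hal. apply Cmod_gt_0 in Hal.
  assert (Hp : 0 < Cmod al / (4 * (M + 1))) by (apply Rdiv_lt_0_compat; lra).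
  (* This radius makes the quadratic error at most half of the linear term; [M + 1] covers the case
     [M = 0]. *)
  exists (Rmin d (Cmod al / (4 * (M + 1)))).
  split; [apply Rmin_pos; auto|].
  set (r := Cmod al / (4 * (M + 1))) in *.
  generalize (Rmin_l d r) (Rmin_r d r). intros Hl Hr y y' Hy Hy'.
  specialize (H y y' ltac:(lra) ltac:(lra)).
  assert (E : Cmod (al * (y - y')) <= Cmod (f y - f y') + Cmod (f y - f y' - al * (y - y'))).
  { rewrite (Cmod_sub_sym (f y - f y')). apply Cmod_le_sub. }
  rewrite Cmod_mult in E.
  assert (M * (Cmod (y - x) + Cmod (y' - x)) <= Cmod al / 2).
  { apply Rle_trans with (M * (2 * r)); [apply Rmult_le_compat_l; lra|].
    assert (Er : (M + 1) * (4 * r) = Cmod al) by (unfold r; field; lra). nra. }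
  assert (M * (Cmod (y - x) + Cmod (y' - x)) * Cmod (y - y') <= Cmod al / 2 * Cmod (y - y'))
    by (apply Rmult_le_compat_r; [apply Cmod_ge_0|auto]).
  lra.
Qed.

(** Covers both roots ([Q] a power) and local inverses ([P] the identity). *)
Lemma sderiv_implicit (P Q F : C -> C) (x al be : C) (r : R) :
  cont_at F x -> 0 < r -> (forall y, Cmod (y - x) < r -> Q (F y) = P y) ->
  sderiv P x be -> sderiv Q (F x) al -> al <> 0%C -> sderiv F x (be / al).
Proof.
  intros HF Hr E HP HQ Hal.
  destruct (sderiv_lower _ _ _ HQ Hal) as [d1 [Hd1 Hlow]].
  destruct HQ as [M [d2 [HM [Hd2 HQ]]]].
  destruct (sderiv_data _ _ _ HP) as [M' [d3 [L [HM' [Hd3 [HL [HP' HLip]]]]]]].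
  destruct (HF (Rmin d1 d2)) as [d4 [Hd4 Hc]]; [apply Rmin_pos; auto|].
  assert (Hm : 0 < Cmod al) by now apply Cmod_gt_0.
  set (K := 2 * L / Cmod al).
  assert (HK : 0 <= K) by (unfold K; apply Rmult_le_pos; [lra|apply Rlt_le, Rinv_0_lt_compat; auto]).
  exists ((M * K * K + M') / Cmod al), (Rmin (Rmin d3 d4) r).
  split. { apply Rmult_le_pos; [|apply Rlt_le, Rinv_0_lt_compat; auto].
    assert (0 <= M * K * K) by (apply Rmult_le_pos; [apply Rmult_le_pos|]; auto). lra. }
  split; [repeat apply Rmin_pos; auto|].
  (* The lower bound for [Q] first makes [F] Lipschitz. Only then does the error of [Q], quadratic
     in values of [F], become quadratic in the arguments. *)
  assert (Hlip : forall y y', Cmod (y - x) < Rmin (Rmin d3 d4) r ->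
     Cmod (y' - x) < Rmin (Rmin d3 d4) r -> Cmod (F y - F y') <= K * Cmod (y - y')).
  { intros y y' Hy Hy'.
    generalize (Rmin_l (Rmin d3 d4) r) (Rmin_r (Rmin d3 d4) r) (Rmin_l d3 d4) (Rmin_r d3 d4)
      (Rmin_l d1 d2). intros.
    assert (A1 := Hc y ltac:(lra)). assert (A2 := Hc y' ltac:(lra)).
    assert (A3 := Hlow (F y) (F y') ltac:(lra) ltac:(lra)).
    rewrite !E in A3 by lra.
    assert (A4 := HLip y y' ltac:(lra) ltac:(lra)).
    unfold K. replace (2 * L / Cmod al * Cmod (y - y')) with ((L * Cmod (y - y')) / (Cmod al / 2))
      by (field; lra).
    apply Rle_div_r; lra. }
  intros y y' Hy Hy'.
  assert (L3 := Hlip y y' Hy Hy').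
  assert (Hx : Cmod (x - x) < Rmin (Rmin d3 d4) r)
    by (rewrite Cmod_sub_diag; repeat apply Rmin_pos; auto).
  assert (L1 := Hlip y x Hy Hx). assert (L2 := Hlip y' x Hy' Hx).
  generalize (Rmin_l (Rmin d3 d4) r) (Rmin_r (Rmin d3 d4) r) (Rmin_l d3 d4) (Rmin_r d3 d4)
      (Rmin_r d1 d2). intros.
  assert (A1 := Hc y ltac:(lra)). assert (A2 := Hc y' ltac:(lra)).
  assert (A3 := HQ (F y) (F y') ltac:(lra) ltac:(lra)).
  rewrite !E in A3 by lra.
  assert (A4 := HP' y y' ltac:(lra) ltac:(lra)).
  set (s := Cmod (y - x) + Cmod (y' - x)) in *. set (h := Cmod (y - y')) in *.
  assert (0 <= s) by (unfold s; generalize (Cmod_ge_0 (y - x)) (Cmod_ge_0 (y' - x)); lra).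
  assert (0 <= h) by apply Cmod_ge_0.
  replace (F y - F y' - be / al * (y - y'))%C with
    ((- (P y - P y' - al * (F y - F y')) + (P y - P y' - be * (y - y'))) / al)%C by (field; auto).
  rewrite Cmod_div by auto.
  replace ((M * K * K + M') / Cmod al * s * h) with ((M * (K * s) * (K * h) + M' * s * h) / Cmod al)
    by (field; lra).
  apply Rmult_le_compat_r; [apply Rlt_le, Rinv_0_lt_compat; auto|].
  eapply Rle_trans; [apply Cmod_triangle|]. rewrite Cmod_opp.
  apply Rplus_le_compat; auto.
  eapply Rle_trans; [apply A3|].
  apply Rmult_le_compat; auto; try apply Cmod_ge_0.
  - apply Rmult_le_pos; auto. generalize (Cmod_ge_0 (F y - F x)) (Cmod_ge_0 (F y' - F x)); lra.
  - apply Rmult_le_compat_l; auto. unfold s. lra.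
Qed.

(** Links the two notions of derivative, since the multiplier is defined by [C_derive]. *)
Lemma sderiv_is_derive (f : C -> C) (x al : C) : sderiv f x al -> C_derive f x = al.
Proof.
  intros [M [d [HM [Hd H]]]]. apply is_C_derive_unique.
  split. { apply is_linear_scal_l. }
  intros x0 Hx0. apply (@is_filter_lim_locally_unique C_AbsRing (AbsRing_NormedModule C_AbsRing)) in Hx0. subst x0.
  intros eps. apply locally_C.
  apply (locally_Cmod x (fun y => norm (minus (minus (f y) (f x)) (scal (minus y x) al)) <= eps * norm (minus y x))).
  assert (He : 0 < eps / (M + 1)) by (apply Rdiv_lt_0_compat; [apply cond_pos|lra]).
  exists (Rmin d (eps / (M + 1))). split; [apply Rmin_pos; auto|].
  intros y Hy. generalize (Rmin_l d (eps / (M + 1))) (Rmin_r d (eps / (M + 1))). intros.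
  specialize (H y x ltac:(lra) ltac:(rewrite Cmod_sub_diag; lra)).
  rewrite Cmod_sub_diag in H.
  change (Cmod (f y - f x - (y - x) * al) <= eps * Cmod (y - x)).
  rewrite (Cmult_comm (y - x) al).
  eapply Rle_trans; [apply H|]. apply Rmult_le_compat_r; [apply Cmod_ge_0|].
  assert ((M + 1) * (eps / (M + 1)) = eps) by (field; lra).
  generalize (Cmod_ge_0 (y - x)). nra.
Qed.

(** * Local inverses and compactness *)

Lemma pow_small (rho A e : R) :
  0 <= rho < 1 -> 0 < e -> exists N, forall k, (N <= k)%nat -> A * rho ^ k < e.
Proof.
  intros Hr He.
  destruct (pow_lt_1_zero rho) with (y := e / (Rabs A + 1)) as [N HN].
  - rewrite Rabs_pos_eq; lra.
  - apply Rdiv_lt_0_compat; auto. generalize (Rabs_pos A); lra.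
  - exists N. intros k Hk. specialize (HN k Hk).
    generalize (Rabs_pos A) (Rle_abs A). intros.
    assert (0 <= rho ^ k) by (apply pow_le; lra).
    rewrite Rabs_pos_eq in HN by auto.
    assert (E : (Rabs A + 1) * (e / (Rabs A + 1)) = e) by (field; lra).
    assert ((Rabs A + 1) * rho ^ k < (Rabs A + 1) * (e / (Rabs A + 1)))
      by (apply Rmult_lt_compat_l; lra).
    nra.
Qed.

Lemma le_0_of_geometric (rho A x : R) :
  0 <= rho < 1 -> (forall k, x <= A * rho ^ k) -> x <= 0.
Proof.
  intros Hr H. destruct (Rle_lt_dec x 0) as [|h]; auto.
  destruct (pow_small rho A x Hr h) as [N HN].
  specialize (HN N (le_n _)). specialize (H N). lra.
Qed.

Lemma geometric_cvg (u : nat -> C) (A rho : R) :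
  0 <= A -> 0 <= rho < 1 -> (forall k, Cmod (u (S k) - u k) <= A * rho ^ k) ->
  exists l, forall k, Cmod (u k - l) <= A / (1 - rho) * rho ^ k.
Proof.
  intros HA Hr H.
  set (B := A / (1 - rho)).
  assert (HB : 0 <= B) by (apply Rmult_le_pos; [lra|apply Rlt_le, Rinv_0_lt_compat; lra]).
  assert (EB : B * (1 - rho) = A) by (unfold B; field; lra).
  assert (T : forall j k, Cmod (u (k + j)%nat - u k) <= B * rho ^ k).
  (* The sharper bound with the factor [1 - rho ^ j] is the exact geometric sum, which lets the
     induction on [j] close. *)
  { intros j k. apply Rle_trans with (B * rho ^ k * (1 - rho ^ j)).
    - induction j as [|j IH].
      + rewrite Nat.add_0_r, Cmod_sub_diag. simpl. lra.
      + eapply Rle_trans; [apply (Cmod_sub_triangle (u (k + j)%nat))|].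
        replace (k + S j)%nat with (S (k + j)) by lia.
        eapply Rle_trans; [apply Rplus_le_compat; [apply H|apply IH]|].
        rewrite <- EB, pow_add. simpl. lra.
    - assert (0 <= B * rho ^ k) by (apply Rmult_le_pos; auto; apply pow_le; lra).
      assert (0 <= rho ^ j) by (apply pow_le; lra). nra. }
  assert (Cau : forall e, 0 < e -> exists N, forall n m, (n >= N)%nat -> (m >= N)%nat ->
             Cmod (u n - u m) < e).
  { intros e He. destruct (pow_small rho B e Hr He) as [N HN]. exists N.
    assert (W : forall n m, (N <= m)%nat -> (m <= n)%nat -> Cmod (u n - u m) < e).
    { intros n m Hm Hmn. replace n with (m + (n - m))%nat by lia.
      eapply Rle_lt_trans; [apply T|]. now apply HN. }
    intros n m Hn Hm. destruct (Nat.le_ge_cases m n).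
    - apply W; lia.
    - rewrite Cmod_sub_sym. apply W; lia. }
  destruct (Rcomplete.R_complete (fun k => Re (u k))) as [l1 Hl1].
  { intros e He. destruct (Cau e He) as [N HN]. exists N. intros n m Hn Hm.
    unfold Rdist. eapply Rle_lt_trans; [|apply (HN n m Hn Hm)]. apply (re_le_Cmod (u n - u m)). }
  destruct (Rcomplete.R_complete (fun k => Im (u k))) as [l2 Hl2].
  { intros e He. destruct (Cau e He) as [N HN]. exists N. intros n m Hn Hm.
    unfold Rdist. eapply Rle_lt_trans; [|apply (HN n m Hn Hm)].
    eapply Rle_trans; [|apply Rmax_Cmod]. apply Rmax_r. }
  exists (l1, l2). intros k.
  apply Rle_plus_epsilon. intros e He.
  destruct (Hl1 (e / 2)) as [N1 HN1]; [lra|]. destruct (Hl2 (e / 2)) as [N2 HN2]; [lra|].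
  specialize (HN1 (k + (N1 + N2))%nat ltac:(lia)). specialize (HN2 (k + (N1 + N2))%nat ltac:(lia)).
  eapply Rle_trans; [apply (Cmod_sub_triangle (u (k + (N1 + N2))%nat))|].
  apply Rplus_le_compat. { rewrite Cmod_sub_sym. apply T. }
  unfold Rdist, Re, Im in *.
  eapply Rle_trans; [apply Cmod_2Rmax|]. simpl.
  assert (sqrt 2 < 2).
  { rewrite <- (sqrt_square 2) at 2 by lra. apply sqrt_lt_1; lra. }
  assert (0 <= sqrt 2) by apply sqrt_pos.
  apply Rle_trans with (2 * (e / 2)); [|lra].
  apply Rmult_le_compat; try lra.
  - eapply Rle_trans; [apply Rabs_pos|apply Rmax_l].
  - apply Rmax_lub; unfold Rminus in *; lra.
Qed.

(** Newton's iteration with the derivative frozen at [al]: near [x] the map [y - (f y - z) / al]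
    halves distances, and its fixed point is the preimage of [z]. Injectivity and the Lipschitz
    bound come from [sderiv_lower]. *)
Lemma sderiv_inverse (f : C -> C) (x al : C) (r : R) :
  sderiv f x al -> al <> 0%C -> 0 < r ->
  exists g rho delta, 0 < rho <= r /\ 0 < delta /\ g (f x) = x /\
    (forall z, Cmod (z - f x) < delta -> Cmod (g z - x) < rho /\ f (g z) = z) /\
    (forall y, Cmod (y - x) < rho -> Cmod (f y - f x) < delta -> g (f y) = y) /\
    (forall z z', Cmod (z - f x) < delta -> Cmod (z' - f x) < delta ->
       Cmod (g z - g z') <= 2 / Cmod al * Cmod (z - z')).
Proof.
  intros Hf Hal Hr.
  destruct (sderiv_lower _ _ _ Hf Hal) as [d1 [Hd1 Hlow]].
  destruct (sderiv_data _ _ _ Hf) as [M [d [L [HM [Hd [HL [HQ HLip]]]]]]].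
  assert (Hm : 0 < Cmod al) by now apply Cmod_gt_0.
  set (m := Cmod al) in *.
  assert (Hp : 0 < m / (4 * (M + 1))) by (apply Rdiv_lt_0_compat; lra).
  set (rho := Rmin (Rmin d d1) (Rmin r (m / (4 * (M + 1))))).
  assert (Hrho : 0 < rho) by (repeat apply Rmin_pos; auto).
  assert (Hrd : rho <= d) by (eapply Rle_trans; [apply Rmin_l|apply Rmin_l]).
  assert (Hrd1 : rho <= d1) by (eapply Rle_trans; [apply Rmin_l|apply Rmin_r]).
  assert (Hrr : rho <= r) by (eapply Rle_trans; [apply Rmin_r|apply Rmin_l]).
  assert (Hrm : rho <= m / (4 * (M + 1))) by (eapply Rle_trans; [apply Rmin_r|apply Rmin_r]).
  clearbody rho.
  assert (HMr : M * (2 * rho) <= m / 2).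
  { assert (E : (M + 1) * (2 * (m / (4 * (M + 1)))) = m / 2) by (field; lra). nra. }
  (* For [z] this close to [f x] the first step has length less than [rho / 4], so with ratio
     [1 / 2] all iterates stay within [rho / 2] of [x]. *)
  set (delta := rho * m / 4).
  assert (Hdelta : 0 < delta) by (unfold delta; nra).
  assert (Ex : forall z, Cmod (z - f x) < delta -> exists y, Cmod (y - x) < rho /\ f y = z).
  { intros z Hz.
    set (T := fun y => (y - (f y - z) / al)%C).
    assert (HT : forall y y', Cmod (y - x) < rho -> Cmod (y' - x) < rho ->
               Cmod (T y - T y') <= / 2 * Cmod (y - y')).
    { intros y y' Hy Hy'. unfold T.
      replace (y - (f y - z) / al - (y' - (f y' - z) / al))%C
        with (- ((f y - f y' - al * (y - y')) / al))%C by (field; auto).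
      rewrite Cmod_opp, Cmod_div by auto. fold m.
      apply Rle_div_l; auto.
      eapply Rle_trans; [apply HQ; lra|].
      assert (M * (Cmod (y - x) + Cmod (y' - x)) <= m / 2)
        by (eapply Rle_trans; [apply Rmult_le_compat_l with (r2 := 2 * rho)|]; lra).
      generalize (Cmod_ge_0 (y - y')). nra. }
    set (y := fix y k := match k with O => x | S k => T (y k) end).
    set (A := Cmod (T x - x)).
    assert (HA : A < rho / 4).
    { unfold A, T. replace (x - (f x - z) / al - x)%C with ((z - f x) / al)%C by (field; auto).
      rewrite Cmod_div by auto. fold m. apply Rlt_div_l; auto. unfold delta in Hz. lra. }
    assert (HA0 : 0 <= A) by apply Cmod_ge_0.
    assert (K : forall k, Cmod (y k - x) <= 2 * A * (1 - (/ 2) ^ k) /\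
                          Cmod (y (S k) - y k) <= A * (/ 2) ^ k).
    { intros k. assert (Hk : forall k, 0 < (/ 2) ^ k) by (intros; apply pow_lt; lra).
      induction k as [|k [IH1 IH2]].
      - simpl. rewrite Cmod_sub_diag. split; [lra|]. fold A. lra.
      - assert (B1 : Cmod (y (S k) - x) <= 2 * A * (1 - (/ 2) ^ S k)).
        { eapply Rle_trans; [apply (Cmod_sub_triangle (y k))|]. simpl. simpl in IH2. lra. }
        split; auto.
        change (y (S (S k))) with (T (y (S k))). change (y (S k)) with (T (y k)) at 2.
        eapply Rle_trans; [apply HT|].
        + generalize (Hk (S k)). nra.
        + generalize (Hk k). nra.
        + change ((/ 2) ^ S k) with (/ 2 * (/ 2) ^ k). lra. }
    destruct (geometric_cvg y A (/ 2)) as [l Hl]; [auto|lra|intros k; apply K|].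
    replace (A / (1 - / 2)) with (2 * A) in Hl by lra.
    assert (Hlx : Cmod (l - x) < rho).
    { specialize (Hl O). simpl in Hl. rewrite Cmod_sub_sym. lra. }
    exists l. split; auto. apply Cmod_sub_eq_0.
    apply le_0_of_geometric with (rho := / 2) (A := L * (2 * A) + m * A); [lra|].
    intros k. destruct (K k) as [K1 K2].
    assert (Hk : 0 < (/ 2) ^ k) by (apply pow_lt; lra).
    assert (Hyk : Cmod (y k - x) < rho) by nra.
    assert (E1 : Cmod (f l - f (y k)) <= L * Cmod (l - y k)) by (apply HLip; lra).
    assert (E2 : (f (y k) - z = - al * (y (S k) - y k))%C).
    { simpl. unfold T. field. auto. }
    eapply Rle_trans; [apply (Cmod_sub_triangle (f (y k)))|].
    rewrite E2, Cmod_mult, Cmod_opp. fold m.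
    specialize (Hl k). rewrite Cmod_sub_sym in Hl. nra. }
  set (g := fun z => epsilon (inhabits x) (fun y => Cmod (y - x) < rho /\ f y = z)).
  assert (Hg : forall z, Cmod (z - f x) < delta -> Cmod (g z - x) < rho /\ f (g z) = z).
  { intros z Hz. apply (epsilon_spec (inhabits x) (fun y => Cmod (y - x) < rho /\ f y = z)).
    auto. }
  assert (Hinj : forall y, Cmod (y - x) < rho -> Cmod (f y - f x) < delta -> g (f y) = y).
  { intros y Hy Hfy. destruct (Hg _ Hfy) as [G1 G2].
    apply Cmod_sub_eq_0. specialize (Hlow (g (f y)) y ltac:(lra) ltac:(lra)).
    rewrite G2, Cmod_sub_diag in Hlow. nra. }
  exists g, rho, delta. repeat split; auto; try apply Hg; auto.
  - apply Hinj; rewrite Cmod_sub_diag; auto.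
  - intros z z' Hz Hz'. destruct (Hg _ Hz) as [G1 G2]. destruct (Hg _ Hz') as [G1' G2'].
    specialize (Hlow (g z) (g z') ltac:(lra) ltac:(lra)). rewrite G2, G2' in Hlow.
    replace (2 / m * Cmod (z - z')) with (Cmod (z - z') / (m / 2)) by (field; lra).
    apply Rle_div_r; lra.
Qed.

(** The common form of the compactness arguments below: a property that weakens as [d] decreases and
    holds locally for some [d] holds on the disc for one [d]. *)
Lemma compact_gauge (r : R) (Q : R -> C -> Prop) :
  (forall d d' w, d' <= d -> Q d w -> Q d' w) ->
  (forall w, Cmod w <= r -> exists d, 0 < d /\ forall w', Cmod (w' - w) < d -> Q d w') ->
  exists d, 0 < d /\ forall w, Cmod w <= r -> Q d w.
Proof.
  intros Hmono H.
  (* The factor [2] exceeds the [sqrt 2] lost in passing from coordinates to the modulus. The square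
     also contains points outside the disc; they receive a gauge so small that no point of the disc
     is seen from them. *)
  assert (D : forall w, exists d : posreal,
             forall w', Cmod (w' - w) < 2 * d -> Cmod w' <= r -> Q d w').
  { intros w. destruct (Rle_lt_dec (Cmod w) r) as [h|h].
    - destruct (H w h) as [d [Hd Hq]]. assert (Hd2 : 0 < d / 2) by lra.
      exists (mkposreal _ Hd2). simpl. intros w' Hw' _. apply (Hmono d); [lra|].
      apply Hq. lra.
    - assert (Hd : 0 < (Cmod w - r) / 2) by lra. exists (mkposreal _ Hd). simpl.
      intros w' Hw' Hr. assert (E := Cmod_le_sub w w'). rewrite Cmod_sub_sym in E. lra. }
  destruct (choice _ D) as [delta Hdelta].
  destruct (compactness_value_2d (- r) r (- r) r (fun u v => delta (u, v))) as [d Hd].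
  exists d. split; [apply cond_pos|]. intros w Hw.
  apply NNPP. intros Hn.
  assert (Hx : Rabs (fst w) <= r)
    by (eapply Rle_trans; [|apply Hw]; eapply Rle_trans; [apply Rmax_l|apply Rmax_Cmod]).
  assert (Hy : Rabs (snd w) <= r)
    by (eapply Rle_trans; [|apply Hw]; eapply Rle_trans; [apply Rmax_r|apply Rmax_Cmod]).
  apply Rabs_le_between in Hx. apply Rabs_le_between in Hy.
  apply (Hd (fst w) (snd w) Hx Hy). intros [u [v [Hu [Hv [H1 [H2 H3]]]]]].
  apply Hn, (Hmono (delta (u, v))); auto. apply Hdelta; auto.
  eapply Rle_lt_trans; [apply Cmod_2Rmax|]. simpl.
  assert (sqrt 2 < 2) by (rewrite <- (sqrt_square 2) at 2 by lra; apply sqrt_lt_1; lra).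
  assert (0 < sqrt 2) by (apply sqrt_lt_R0; lra).
  apply Rle_lt_trans with (2 * Rmax (Rabs (fst w + - u)) (Rabs (snd w + - v))).
  - apply Rmult_le_compat_r; [|lra]. eapply Rle_trans; [apply Rabs_pos|apply Rmax_l].
  - apply Rmult_lt_compat_l; [lra|]. apply Rmax_lub_lt; auto.
Qed.

Lemma interval_net (r d : R) :
  0 < d -> exists l : list R, forall x, Rabs x <= r -> exists y, In y l /\ Rabs (x - y) <= d.
Proof.
  intros Hd.
  destruct (nfloor_ex (Rmax 0 (2 * r / d))) as [N HN]; [apply Rmax_l|].
  exists (map (fun i => - r + INR i * d) (seq 0 (S N))).
  intros x Hx. apply Rabs_le_between in Hx.
  assert (Hx0 : 0 <= (x + r) / d) by (apply Rdiv_le_0_compat; lra).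
  destruct (nfloor_ex ((x + r) / d) Hx0) as [i Hi].
  exists (- r + INR i * d). split.
  - apply (in_map (fun i => - r + INR i * d)). apply in_seq. split; [lia|]. simpl.
    assert (INR i < INR N + 1); [|rewrite <- S_INR in *; now apply INR_lt].
    eapply Rle_lt_trans; [|apply HN]. eapply Rle_trans; [apply Hi|].
    eapply Rle_trans; [|apply Rmax_r].
    apply Rmult_le_compat_r; [apply Rlt_le, Rinv_0_lt_compat; auto|lra].
  - assert (E : x = (x + r) / d * d - r) by (field; lra).
    apply Rabs_le_between. nra.
Qed.

(** The gauge [d] is a Lebesgue number of the cover. Points within [d / 2] of the same net point lie
    within [d] of each other, so one open set per net point suffices. *)
Lemma compact_closed_disc (r : R) : compact_set (fun w => Cmod w <= r).
Proof.
  intros I U HU Hcov.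
  destruct (compact_gauge r (fun d w => exists i, forall w', Cmod (w' - w) < d -> U i w'))
    as [d [Hd HQ]].
  - intros d d' w Hd [i Hi]. exists i. intros w' Hw'. apply Hi. lra.
  - intros w Hw. destruct (Hcov w Hw) as [i Hi].
    apply HU, locally_Cmod in Hi. destruct Hi as [d [Hd Hi]].
    exists (d / 2). split; [lra|]. intros w' Hw'. exists i. intros w2 Hw2. apply Hi.
    eapply Rle_lt_trans; [apply (Cmod_sub_triangle w')|]. lra.
  - destruct (interval_net r (d / 8)) as [l Hl]; [lra|].
    assert (Hnet : forall w, Cmod w <= r ->
              exists c, In c (list_prod l l) /\ Cmod (w - c) < d / 2).
    { intros w Hw.
      destruct (Hl (fst w)) as [x [Hx1 Hx2]].
      { eapply Rle_trans; [|apply Hw]. eapply Rle_trans; [apply Rmax_l|apply Rmax_Cmod]. }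
      destruct (Hl (snd w)) as [y [Hy1 Hy2]].
      { eapply Rle_trans; [|apply Hw]. eapply Rle_trans; [apply Rmax_r|apply Rmax_Cmod]. }
      exists (x, y). split; [now apply in_prod|].
      eapply Rle_lt_trans; [apply Cmod_2Rmax|]. simpl.
      assert (sqrt 2 < 2) by (rewrite <- (sqrt_square 2) at 2 by lra; apply sqrt_lt_1; lra).
      assert (0 <= sqrt 2) by apply sqrt_pos.
      apply Rle_lt_trans with (2 * (d / 8)); [|lra].
      apply Rmult_le_compat; try lra.
      - eapply Rle_trans; [apply Rabs_pos|apply Rmax_l].
      - apply Rmax_lub; auto. }
    assert (Hfin : forall L : list C, exists s : list I, forall w c, In c L -> Cmod w <= r ->
              Cmod (w - c) < d / 2 -> exists i, In i s /\ U i w).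
    { induction L as [|c L [s Hs]].
      - exists nil. intros w c [].
      - destruct (classic (exists w0, Cmod w0 <= r /\ Cmod (w0 - c) < d / 2)) as [[w0 [H1 H2]]|Hn].
        + destruct (HQ w0 H1) as [i Hi]. exists (i :: s). intros w c' [<-|Hc] Hw Hwc.
          * exists i. split; [now left|]. apply Hi.
            eapply Rle_lt_trans; [apply (Cmod_sub_triangle c)|].
            rewrite (Cmod_sub_sym c). lra.
          * destruct (Hs w c' Hc Hw Hwc) as [j [Hj1 Hj2]]. exists j. split; auto. now right.
        + exists s. intros w c' [<-|Hc] Hw Hwc; [|eauto].
          exfalso. apply Hn. eauto. }
    destruct (Hfin (list_prod l l)) as [s Hs]. exists s. intros w Hw.
    destruct (Hnet w Hw) as [c [Hc1 Hc2]]. eauto.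
Qed.

Lemma bounded_seq_iff (z : nat -> C) :
  bounded_seq z <-> exists M, forall j, Cmod (z j) <= M.
Proof.
  split.
  - intros [K [HK Hz]].
    destruct (HK nat (fun n w => Cmod w < INR n)) as [s Hs].
    + intros n w Hw. apply locally_Cmod. exists (INR n - Cmod w). split; [lra|].
      intros y Hy. assert (E := Cmod_le_sub y w). lra.
    + intros w _. destruct (nfloor_ex (Cmod w) (Cmod_ge_0 w)) as [n Hn].
      exists (S n). rewrite S_INR. lra.
    + exists (INR (list_max s)). intros j. destruct (Hs (z j) (Hz j)) as [i [Hi1 Hi2]].
      apply Rlt_le. eapply Rlt_le_trans; [apply Hi2|]. apply le_INR.
      assert (F := proj1 (list_max_le s (list_max s)) (le_n _)).
      rewrite Forall_forall in F. auto.
  - intros [M HM]. exists (fun w => Cmod w <= M). split; auto. apply compact_closed_disc.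
Qed.

(** * Self-similarity at a repelling fixed point *)

(** The nearby point [w'] may fall outside the disc; it is then moved radially to the boundary
    circle, over a distance of at most [e]. This accounts for the factor [2] and shows why the
    circle belongs to the truncation. *)
Lemma truncate_thickening (r e : R) (X Y : C -> Prop) :
  0 < r -> 0 <= e ->
  (forall w, X w -> Cmod w <= r -> exists w', Y w' /\ Cmod (w - w') <= e) ->
  in_thickening (2 * e) (truncate r X) (truncate r Y).
Proof.
  intros Hr He H w [[Hw Hle]|Heq].
  - destruct (H w Hw Hle) as [w' [Hw' Hd]].
    destruct (Rle_lt_dec (Cmod w') r) as [h|h].
    + exists w'. split; [left; auto|lra].
    + assert (Hw0 : w' <> 0%C) by (apply Cmod_gt_0; lra).
      assert (Hr0 : RtoC (Cmod w') <> 0%C) by (intros E; apply RtoC_inj in E; lra).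
      exists (RtoC r / RtoC (Cmod w') * w')%C. split.
      * right. rewrite Cmod_mult, Cmod_div, !Cmod_R, !Rabs_pos_eq by (auto; lra). field. lra.
      * eapply Rle_trans; [apply (Cmod_sub_triangle w')|].
        assert (Cmod (w' - r / Cmod w' * w') = Cmod w' - r).
        { replace (w' - r / Cmod w' * w')%C with (RtoC ((Cmod w' - r) / Cmod w') * w')%C.
          - rewrite Cmod_mult, Cmod_R, Rabs_pos_eq; [field; lra|].
            apply Rdiv_le_0_compat; lra.
          - rewrite RtoC_div, RtoC_minus by lra. field. auto. }
        assert (E := Cmod_le_sub w' w). rewrite Cmod_sub_sym in E. lra.
  - exists w. split; [now right|]. rewrite Cmod_sub_diag. lra.
Qed.

Lemma hausdorff_cvg_intro (X : nat -> C -> Prop) (Y : C -> Prop) :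
  (forall e, 0 < e -> exists N, forall k, (N <= k)%nat ->
     in_thickening e (X k) Y /\ in_thickening e Y (X k)) -> hausdorff_cvg X Y.
Proof.
  intros H e He. destruct (H (e / 2)) as [N HN]; [lra|]. exists N. intros k Hk.
  apply Rbar_le_lt_trans with (e / 2); [|simpl; lra].
  apply Glb_Rbar_correct. destruct (HN k Hk). repeat split; auto. lra.
Qed.

Lemma Rdiv_le_self (x t : R) : 0 <= x -> 1 <= t -> x / t <= x.
Proof.
  intros Hx Ht. apply Rle_div_l; [lra|]. rewrite <- (Rmult_1_r x) at 1.
  apply Rmult_le_compat_l; auto.
Qed.

(** [kap] will bound the contraction of the inverse branch, whose derivative has modulus [/ m]. The
    quadratic error after [k] steps is of order [(kap ^ k) ^ 2] and is dilated by [m ^ k], so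
    convergence asks for [m * kap ^ 2 < 1]. Any value between [/ m] and its square root [tau]
    serves. *)
Lemma contraction_rate (m : R) :
  1 < m -> exists kap, / m < kap < 1 /\ 0 <= m * (kap * kap) < 1.
Proof.
  intros Hm. set (tau := sqrt (/ m)).
  assert (H0 : 0 < / m) by (apply Rinv_0_lt_compat; lra).
  assert (H1 : / m < 1) by (rewrite <- Rinv_1; apply Rinv_lt_contravar; lra).
  assert (E : tau * tau = / m) by (apply sqrt_sqrt; lra).
  assert (Ht : 0 < tau) by (apply sqrt_lt_R0; auto).
  assert (Ht1 : tau < 1) by nra.
  assert (Em : m * (tau * tau) = 1) by (rewrite E; field; lra).
  exists (tau * ((1 + tau) / 2)). rewrite <- E. split; [split; nra|].
  replace (m * (tau * ((1 + tau) / 2) * (tau * ((1 + tau) / 2))))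
    with (m * (tau * tau) * ((1 + tau) / 2 * ((1 + tau) / 2))) by ring.
  rewrite Em. split; nra.
Qed.

Lemma sderiv_fixed_quadratic (f : C -> C) (x al : C) :
  sderiv f x al -> exists M d, 0 <= M /\ 0 < d /\
    forall y, Cmod (y - x) < d ->
      Cmod (f y - f x - al * (y - x)) <= M * (Cmod (y - x) * Cmod (y - x)).
Proof.
  intros [M [d [HM [Hd H]]]]. exists M, d. repeat split; auto.
  intros y Hy. specialize (H y x Hy ltac:(rewrite Cmod_sub_diag; auto)).
  rewrite Cmod_sub_diag in H. lra.
Qed.

Lemma sderiv_local_inverse (f : C -> C) (x al : C) (r : R) :
  sderiv f x al -> al <> 0%C -> 0 < r ->
  exists g rho delta, 0 < rho <= r /\ 0 < delta /\ g (f x) = x /\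
    (forall z, Cmod (z - f x) < delta -> Cmod (g z - x) < rho /\ f (g z) = z) /\
    (forall y, Cmod (y - x) < rho -> Cmod (f y - f x) < delta -> g (f y) = y) /\
    sderiv g (f x) (/ al).
Proof.
  intros Hf Hal Hr.
  destruct (sderiv_inverse f x al r Hf Hal Hr)
    as [g [rho [delta [H1 [H2 [H3 [H4 [H5 H6]]]]]]]].
  exists g, rho, delta. repeat split; try tauto; try apply H4; auto.
  replace (/ al)%C with (1 / al)%C by (unfold Cdiv; ring).
  apply (sderiv_implicit (fun w => w) f g _ _ _ delta); auto.
  - intros e He. assert (Hm : 0 < Cmod al) by now apply Cmod_gt_0.
    exists (Rmin delta (e * (Cmod al / 2))). split; [apply Rmin_pos; auto; nra|].
    intros y Hy. generalize (Rmin_l delta (e * (Cmod al / 2))) (Rmin_r delta (e * (Cmod al / 2))).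
    intros. eapply Rle_lt_trans; [apply H6; [lra|rewrite Cmod_sub_diag; auto]|].
    replace (2 / Cmod al * Cmod (y - f x)) with (Cmod (y - f x) / (Cmod al / 2)) by (field; lra).
    apply Rlt_div_l; lra.
  - intros y Hy. now apply H4.
  - apply sderiv_id.
  - rewrite H3. auto.
Qed.

(** Koenigs' linearization: with [g], [H] the local inverses of [h], [G], the
    maps [lam ^ k * (H (g^k z) - x')] converge geometrically and uniformly near
    [x], and carry [K] near [x] to the dilated sets. *)
Lemma self_similar_of_repelling (K : C -> Prop) (x x' lam al : C) (h G : C -> C) :
  closed K -> K x' -> 1 < Cmod lam -> h x = x -> sderiv h x lam ->
  G x' = x -> sderiv G x' al -> al <> 0%C ->
  (exists r, 0 < r /\ forall y, Cmod (y - x) < r -> (K y <-> K (h y))) ->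
  (exists r, 0 < r /\ forall y, Cmod (y - x') < r -> (K y <-> K (G y))) ->
  asymptotically_self_similar lam K x'.
Proof.
  intros HK Kx' Hm hx Dh Gx' DG Hal [rK [HrK HKh]] [rG [HrG HKG]].
  set (m := Cmod lam) in *.
  assert (Hlam : lam <> 0%C) by (apply Cmod_gt_0; fold m; lra).
  assert (Kx : K x) by (rewrite <- Gx'; apply (HKG x'); [rewrite Cmod_sub_diag|]; auto).
  destruct (sderiv_local_inverse h x lam rK Dh Hlam HrK)
    as [g [rg [dg [Hrg [Hdg [gx [Hg [Hgh Dg]]]]]]]].
  destruct (sderiv_local_inverse G x' al rG DG Hal HrG)
    as [H [rH [dH [HrH [HdH [Hx [HH [HHG DH]]]]]]]].
  rewrite hx in *. rewrite Gx' in *.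
  destruct (contraction_rate m Hm) as [kap [[Hk1 Hk2] [Hs0 Hs1]]].
  set (sig := m * (kap * kap)) in *.
  assert (Hkap : 0 < kap) by (eapply Rlt_trans; [apply Rinv_0_lt_compat|apply Hk1]; lra).
  destruct (sderiv_fixed_quadratic _ _ _ Dg) as [Mg [d1 [HMg [Hd1 Qg]]]]. rewrite gx in Qg.
  destruct (sderiv_fixed_quadratic _ _ _ Dh) as [Mh [d2 [HMh [Hd2 Qh]]]]. rewrite hx in Qh.
  destruct (sderiv_data _ _ _ DG) as [MG [d3 [LG [HMG [Hd3 [HLG [_ LipG]]]]]]].
  (* The derivative of [lam * H (g y) - H y] at [x] is [lam * (/ al * / lam) - / al], which is zero,
     so consecutive approximants differ by a quadratic term. *)
  assert (DPsi : exists M d, 0 <= M /\ 0 < d /\ forall y, Cmod (y - x) < d ->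
      Cmod (lam * (H (g y) - x') - (H y - x')) <= M * (Cmod (y - x) * Cmod (y - x))).
  { assert (D1 : sderiv (fun y => H (g y)) x (/ al * / lam)).
    { apply sderiv_comp; auto. rewrite gx. auto. }
    assert (D2 := sderiv_mult _ _ _ _ _ (sderiv_const lam x) D1).
    assert (D3 := sderiv_mult _ _ _ _ _ (sderiv_const (-1) x) DH).
    assert (D4 := sderiv_plus _ _ _ _ _ D2 D3).
    apply sderiv_fixed_quadratic in D4. destruct D4 as [M [d [HM [Hd Q]]]].
    exists M, d. repeat split; auto. intros y Hy. specialize (Q y Hy).
    rewrite gx, Hx in Q.
    replace (lam * (H (g y) - x') - (H y - x'))%C with
      (lam * H (g y) + -1 * H y - (lam * x' + -1 * x') -
        (0 * x' + lam * (/ al * / lam) + (0 * x' + -1 * / al)) * (y - x))%C; auto.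
    field. auto. }
  destruct DPsi as [MP [d4 [HMP [Hd4 QP]]]].
  assert (Hkm : 0 < (kap - / m) / (Mg + 1)) by (apply Rdiv_lt_0_compat; lra).
  assert (Hs : exists s, 0 < s /\ s < d1 /\ s < d2 /\ s < d4 /\ s < dg /\ s < rg /\ s < dH
             /\ s < rK /\ s < (kap - / m) / (Mg + 1)).
  { exists (Rmin (Rmin (Rmin d1 d2) (Rmin d4 dg)) (Rmin (Rmin rg dH) (Rmin rK ((kap - / m) / (Mg + 1)))) / 2).
    set (v := Rmin _ _).
    assert (0 < v) by (unfold v; repeat apply Rmin_pos; tauto).
    assert (v <= d1 /\ v <= d2 /\ v <= d4 /\ v <= dg /\ v <= rg /\ v <= dH /\ v <= rK
            /\ v <= (kap - / m) / (Mg + 1)).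
    { unfold v. repeat split;
      repeat first [apply Rle_refl | eapply Rle_trans; [apply Rmin_l|]; apply Rle_refl
        | eapply Rle_trans; [apply Rmin_l|eapply Rle_trans; [apply Rmin_l|apply Rmin_l]]
        | eapply Rle_trans; [apply Rmin_l|eapply Rle_trans; [apply Rmin_l|apply Rmin_r]]
        | eapply Rle_trans; [apply Rmin_l|eapply Rle_trans; [apply Rmin_r|apply Rmin_l]]
        | eapply Rle_trans; [apply Rmin_l|eapply Rle_trans; [apply Rmin_r|apply Rmin_r]]
        | eapply Rle_trans; [apply Rmin_r|eapply Rle_trans; [apply Rmin_l|apply Rmin_l]]
        | eapply Rle_trans; [apply Rmin_r|eapply Rle_trans; [apply Rmin_l|apply Rmin_r]]
        | eapply Rle_trans; [apply Rmin_r|eapply Rle_trans; [apply Rmin_r|apply Rmin_l]]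
        | eapply Rle_trans; [apply Rmin_r|eapply Rle_trans; [apply Rmin_r|apply Rmin_r]]]. }
    clearbody v. repeat split; lra. }
  destruct Hs as [s [Hs [Hsd1 [Hsd2 [Hsd4 [Hsdg [Hsrg [HsdH [HsrK Hsk]]]]]]]]].
  assert (Hgc : forall z, Cmod (z - x) <= s -> Cmod (g z - x) <= kap * Cmod (z - x)).
  { intros z Hz. assert (Q := Qg z ltac:(lra)).
    eapply Rle_trans; [apply (Cmod_le_sub _ (/ lam * (z - x)))|].
    rewrite Cmod_mult, Cmod_inv by auto. fold m.
    assert (E : (Mg + 1) * ((kap - / m) / (Mg + 1)) = kap - / m) by (field; lra).
    assert (Mg * Cmod (z - x) <= kap - / m).
    { rewrite <- E. generalize (Cmod_ge_0 (z - x)). intros. apply Rmult_le_compat; lra. }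
    generalize (Cmod_ge_0 (z - x)). nra. }
  assert (Hgk : forall z k, Cmod (z - x) <= s -> Cmod (Nat.iter k g z - x) <= kap ^ k * s).
  { intros z k Hz. induction k as [|k IH]; [simpl; lra|].
    assert (Hp : 0 <= kap ^ k <= 1).
    { split; [apply pow_le; lra|]. rewrite <- (pow1 k). apply pow_incr. lra. }
    change (Nat.iter (S k) g z) with (g (Nat.iter k g z)).
    eapply Rle_trans; [apply Hgc; nra|]. simpl. nra. }
  assert (Hgk1 : forall z k, Cmod (z - x) <= s -> Cmod (Nat.iter k g z - x) <= s).
  { intros z k Hz. eapply Rle_trans; [apply Hgk; auto|].
    assert (0 <= kap ^ k <= 1).
    { split; [apply pow_le; lra|]. rewrite <- (pow1 k). apply pow_incr. lra. }
    nra. }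
  assert (HgK : forall z k, Cmod (z - x) <= s -> K z -> K (Nat.iter k g z)).
  { intros z k Hz Kz. induction k as [|k IH]; auto.
    change (Nat.iter (S k) g z) with (g (Nat.iter k g z)).
    assert (B := Hgk1 z k Hz). destruct (Hg (Nat.iter k g z)) as [B1 B2]; [lra|].
    apply (HKh (g (Nat.iter k g z))); [lra|]. rewrite B2. auto. }
  set (th := fun k z => (lam ^ k * (H (Nat.iter k g z) - x'))%C).
  set (A := MP * (s * s)).
  assert (HA : 0 <= A) by (unfold A; nra).
  set (B0 := A / (1 - sig)).
  assert (Hth : forall z, Cmod (z - x) <= s ->
                 exists l, forall k, Cmod (th k z - l) <= B0 * sig ^ k).
  { intros z Hz. apply geometric_cvg; auto.
    intros k. unfold th.
    replace (lam ^ S k * (H (Nat.iter (S k) g z) - x') - lam ^ k * (H (Nat.iter k g z) - x'))%C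
      with (lam ^ k * (lam * (H (g (Nat.iter k g z)) - x') - (H (Nat.iter k g z) - x')))%C
      by (simpl; ring).
    rewrite Cmod_mult, Cmod_pow. fold m.
    assert (B := Hgk z k Hz). assert (B' := Hgk1 z k Hz).
    assert (Q := QP (Nat.iter k g z) ltac:(lra)).
    unfold sig, A. rewrite !Rpow_mult_distr.
    assert (0 <= m ^ k) by (apply pow_le; lra).
    replace (MP * (s * s) * (m ^ k * (kap ^ k * kap ^ k)))
      with (m ^ k * (MP * ((kap ^ k * s) * (kap ^ k * s)))) by ring.
    apply Rmult_le_compat_l; auto. eapply Rle_trans; [apply Q|].
    apply Rmult_le_compat_l; auto.
    apply Rmult_le_compat; auto; apply Cmod_ge_0. }
  split; auto. split; auto. split; auto.
  (* The [l] are the Koenigs coordinates, divided by [al], of the points of [K] near [x]. Asking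
     only for approximation up to every [e] takes the closure of their set. *)
  exists (fun w => forall e, 0 < e -> exists z l, K z /\ Cmod (z - x) <= s /\
            (forall k, Cmod (th k z - l) <= B0 * sig ^ k) /\ Cmod (l - w) < e).
  split.
  { intros w Hw e He. apply NNPP. intros Hn. apply Hw. apply locally_Cmod.
    exists (e / 2). split; [lra|]. intros y Hy Hc.
    destruct (Hc (e / 2)) as [z [l [C1 [C2 [C3 C4]]]]]; [lra|].
    apply Hn. exists z, l. repeat split; auto.
    eapply Rle_lt_trans; [apply (Cmod_sub_triangle y)|]. lra. }
  split.
  { destruct (Hth x) as [l Hl]; [rewrite Cmod_sub_diag; lra|].
    exists l. intros e He. exists x, l. repeat split; auto; rewrite Cmod_sub_diag; lra. }
  (* The last two bounds keep [k] forward iterates of [h] inside the disc of radius [s] and let the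
     growth estimate below absorb the quadratic errors. *)
  assert (Hr : exists r, 0 < r /\ r < rH /\ r < d3 /\ 2 * (LG * r) < s /\
                  1 + 4 * Mh * (LG * r) <= m).
  { exists (Rmin (Rmin (rH / 2) (d3 / 2)) (Rmin (s / (4 * (LG + 1))) ((m - 1) / (4 * (Mh + 1) * (LG + 1))))).
    assert (0 < s / (4 * (LG + 1))) by (apply Rdiv_lt_0_compat; lra).
    assert (0 < (m - 1) / (4 * (Mh + 1) * (LG + 1))) by (apply Rdiv_lt_0_compat; nra).
    set (r := Rmin _ _).
    assert (0 < r) by (unfold r; repeat apply Rmin_pos; lra).
    assert (r <= rH / 2) by (eapply Rle_trans; [apply Rmin_l|apply Rmin_l]).
    assert (r <= d3 / 2) by (eapply Rle_trans; [apply Rmin_l|apply Rmin_r]).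
    assert (R1 : r <= s / (4 * (LG + 1))) by (eapply Rle_trans; [apply Rmin_r|apply Rmin_l]).
    assert (R2 : r <= (m - 1) / (4 * (Mh + 1) * (LG + 1)))
      by (eapply Rle_trans; [apply Rmin_r|apply Rmin_r]).
    clearbody r. apply Rle_div_r in R1; [|lra]. apply Rle_div_r in R2; [|nra].
    assert (Mh * (LG * r) <= (Mh + 1) * ((LG + 1) * r)) by (apply Rmult_le_compat; nra).
    repeat split; lra || nra. }
  destruct Hr as [r [Hr [HrrH [Hrd3 [Hrs Hrm]]]]].
  set (r1 := LG * r) in *. assert (Hr1 : 0 <= r1) by (unfold r1; nra). 
  exists r. split; auto.
  (* Conversely, every point of the [k]-th dilated set in the disc is a value of [th k]: its source
     is found by applying [G] and then [h] forward [k] times, which undoes [H] and the [k] iterates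
     of [g]. *)
  assert (Hcov : forall k w, Cmod w <= r -> K (x' + w / lam ^ k)%C ->
            exists z, K z /\ Cmod (z - x) <= s /\ th k z = w).
  { intros k w Hw Kw. set (y0 := (x' + w / lam ^ k)%C) in *.
    assert (Hlk : (lam ^ k <> 0)%C) by (apply Cpow_nz; auto).
    assert (Hmk : 1 <= m ^ k) by (apply pow_R1_Rle; lra).
    assert (Hy0 : Cmod (y0 - x') <= r / m ^ k).
    { unfold y0. replace (x' + w / lam ^ k - x')%C with (w / lam ^ k)%C by ring.
      rewrite Cmod_div, Cmod_pow by auto. fold m.
      apply Rmult_le_compat_r; auto. apply Rlt_le, Rinv_0_lt_compat; lra. }
    assert (Hrk : r / m ^ k <= r) by (apply Rdiv_le_self; lra).
    assert (HGy : Cmod (G y0 - x) <= r1 / m ^ k).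
    { rewrite <- Gx'. eapply Rle_trans; [apply LipG; [lra|rewrite Cmod_sub_diag; auto]|].
      unfold r1. unfold Rdiv. rewrite Rmult_assoc. apply Rmult_le_compat_l; auto. }
    set (y := fun i => Nat.iter i h (G y0)).
    (* With [b = m ^ i / m ^ k], the linear growth alone would give [r1 * b]. The factor [1 + b]
       gains [r1 * b * b * (m * (m - 1))] at each step, which dominates the quadratic error
       [Mh * (2 * r1 * b) ^ 2] by the choice of [r]. *)
    assert (Hy : forall i, (i <= k)%nat ->
       Cmod (y i - x) <= r1 * (m ^ i / m ^ k) * (1 + m ^ i / m ^ k) /\ K (y i) /\
       Nat.iter i g (y i) = G y0).
    { assert (Hb : forall i, (i <= k)%nat -> 0 < m ^ i / m ^ k <= 1).
      { intros i Hi. split; [apply Rdiv_lt_0_compat; apply pow_lt; lra|].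
        apply Rle_div_l; [lra|]. rewrite Rmult_1_l. apply Rle_pow; [lra|auto]. }
      assert (Hsm : forall i, (i <= k)%nat ->
         Cmod (y i - x) <= r1 * (m ^ i / m ^ k) * (1 + m ^ i / m ^ k) ->
         Cmod (y i - x) <= 2 * r1 * (m ^ i / m ^ k) /\ Cmod (y i - x) < s).
      { intros i Hi E. specialize (Hb i Hi).
        set (b := m ^ i / m ^ k) in *.
        assert (0 <= r1 * b) by (apply Rmult_le_pos; lra).
        assert (r1 * b * (1 + b) <= r1 * b * 2) by (apply Rmult_le_compat_l; lra).
        assert (r1 * b <= r1 * 1) by (apply Rmult_le_compat_l; lra).
        split; lra. }
      induction i as [|i IH]; intros Hi.
      - split; [|split; auto].
        + specialize (Hb O Hi). simpl in *. unfold Rdiv in *. rewrite Rmult_1_l in *.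
          assert (0 <= r1 * / m ^ k) by (apply Rmult_le_pos; lra). nra.
        + change (y O) with (G y0). apply (HKG y0); auto. lra.
      - destruct (IH ltac:(lia)) as [I1 [I2 I3]].
        destruct (Hsm i ltac:(lia) I1) as [I4 I5].
        assert (Hb1 := Hb i ltac:(lia)). assert (Hb2 := Hb (S i) Hi).
        assert (Eb : m ^ S i / m ^ k = m * (m ^ i / m ^ k)) by (simpl; field; lra).
        set (b := m ^ i / m ^ k) in *.
        change (y (S i)) with (h (y i)).
        assert (N : Cmod (h (y i) - x) <= r1 * (m ^ S i / m ^ k) * (1 + m ^ S i / m ^ k)).
        { rewrite Eb. assert (Q := Qh (y i) ltac:(lra)).
          eapply Rle_trans; [apply (Cmod_le_sub _ (lam * (y i - x)))|].
          rewrite Cmod_mult. fold m. set (u := Cmod (y i - x)) in *.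
          assert (0 <= u) by apply Cmod_ge_0.
          assert (Q1 : Mh * (u * u) <= Mh * (2 * r1 * b * (2 * r1 * b)))
            by (apply Rmult_le_compat_l; auto; apply Rmult_le_compat; auto).
          assert (Q2 : m * u <= m * (r1 * b * (1 + b))) by (apply Rmult_le_compat_l; lra).
          assert (0 <= r1 * b) by (apply Rmult_le_pos; lra).
          assert (0 <= r1 * b * b) by (apply Rmult_le_pos; lra).
          replace (r1 * (m * b) * (1 + m * b)) with (m * (r1 * b * (1 + b)) + r1 * b * b * (m * (m - 1)))
            by ring.
          replace (Mh * (2 * r1 * b * (2 * r1 * b))) with (r1 * b * b * (4 * Mh * r1)) in Q1 by ring.
          assert (r1 * b * b * (4 * Mh * r1) <= r1 * b * b * (m * (m - 1)))
            by (apply Rmult_le_compat_l; [auto|]; assert (0 <= (m - 1) * (m - 1)) by apply Rle_0_sqr; lra).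
          lra. }
        split; auto.
        split. { apply (HKh (y i)); [lra|auto]. }
        rewrite Nat.iter_succ_r, Hgh; auto; [lra|].
        destruct (Hsm (S i) Hi N) as [_ I6]. change (y (S i)) with (h (y i)) in I6. lra. }
    destruct (Hy k (le_n _)) as [Y1 [Y2 Y3]].
    exists (y k). split; auto.
    assert (Ek : m ^ k / m ^ k = 1) by (field; lra). rewrite Ek in Y1.
    split; [lra|]. unfold th. rewrite Y3, HHG.
    - unfold y0. field. auto.
    - lra.
    - assert (r1 / m ^ k <= r1) by (apply Rdiv_le_self; lra). lra. }
  apply hausdorff_cvg_intro. intros e He.
  destruct (pow_small sig B0 (e / 4)) as [N HN]; [lra|lra|].
  exists N. intros k Hk. specialize (HN k Hk).
  replace e with (2 * (e / 2)) by field. split.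
  - apply truncate_thickening; auto; [lra|].
    intros w [z [[y [Ky Ez]] Ew]] Hw.
    assert (Hlk : (lam ^ k <> 0)%C) by (apply Cpow_nz; auto).
    destruct (Hcov k w Hw) as [v [V1 [V2 V3]]].
    { replace (x' + w / lam ^ k)%C with y; auto. rewrite Ew, Ez. field. auto. }
    destruct (Hth v V2) as [l Hl]. exists l. split.
    + intros e' He'. exists v, l. repeat split; auto. rewrite Cmod_sub_diag. auto.
    + rewrite <- V3. specialize (Hl k). lra.
  - apply truncate_thickening; auto; [lra|].
    intros w Hw Hwr. destruct (Hw (e / 4)) as [z [l [Z1 [Z2 [Z3 Z4]]]]]; [lra|].
    exists (th k z). split.
    + exists (H (Nat.iter k g z) - x')%C. split; [|reflexivity].
      exists (H (Nat.iter k g z)). split; [|reflexivity].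
      assert (B := Hgk1 z k Z2). destruct (HH (Nat.iter k g z)) as [B1 B2]; [lra|].
      apply (HKG (H (Nat.iter k g z))); [lra|]. rewrite B2. auto.
    + rewrite Cmod_sub_sym. eapply Rle_trans; [apply (Cmod_sub_triangle l)|].
      specialize (Z3 k). lra.
Qed.

(** * Bounded orbits and pseudo-orbits *)

Lemma pow_incr_strict (x y : R) (k : nat) : 0 <= x < y -> (0 < k)%nat -> x ^ k < y ^ k.
Proof.
  intros Hxy Hk. destruct k as [|k]; [lia|]. simpl.
  assert (x ^ k <= y ^ k) by (apply pow_incr; lra).
  assert (0 < y ^ k) by (apply pow_lt; lra).
  assert (x * x ^ k <= x * y ^ k) by (apply Rmult_le_compat_l; lra).
  assert (x * y ^ k < y * y ^ k) by (apply Rmult_lt_compat_r; lra).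
  lra.
Qed.

(** If [Cmod (w - c) < 3 * Cmod z], then [Cmod z ^ p < 3 ^ q * Cmod z ^ q <= Cmod z ^ (S q)],
    against [q < p]. Otherwise subtracting [Cmod c <= Cmod z] leaves the factor [2]. *)
Lemma corr_escape (p q : nat) (c z w : C) :
  (0 < q)%nat -> (q < p)%nat -> 3 ^ q + Cmod c <= Cmod z -> corr p q c z w ->
  2 * Cmod z <= Cmod w.
Proof.
  intros Hq Hpq Hz H. unfold corr in H. apply (f_equal Cmod) in H. rewrite !Cmod_pow in H.
  assert (H3 : 1 <= 3 ^ q) by (apply pow_R1_Rle; lra).
  generalize (Cmod_ge_0 c) (Cmod_ge_0 (w - c)). intros Hc Hwc.
  destruct (Rle_lt_dec (3 * Cmod z) (Cmod (w - c))) as [h|h].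
  - assert (E := Cmod_sub_le w c). lra.
  - exfalso.
    assert (A : Cmod (w - c) ^ q < (3 * Cmod z) ^ q) by (apply pow_incr_strict; [lra|lia]).
    assert (B : (3 * Cmod z) ^ q <= Cmod z ^ p); [|lra].
    rewrite Rpow_mult_distr. apply Rle_trans with (Cmod z ^ (S q)).
    + simpl. apply Rmult_le_compat_r; [apply pow_le; lra|lra].
    + apply Rle_pow; [lra|lia].
Qed.

Lemma orbit_bound (p q : nat) (c z0 : C) (z : nat -> C) (r : R) :
  (0 < q)%nat -> (q < p)%nat -> 3 ^ q + Cmod c <= r ->
  bounded_forward_orbit p q c z0 z -> forall j, Cmod (z j) <= r.
Proof.
  intros Hq Hpq Hr [_ [Hz Hb]] j. apply bounded_seq_iff in Hb. destruct Hb as [M HM].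
  destruct (Rle_lt_dec (Cmod (z j)) r) as [h|h]; auto. exfalso.
  assert (H3 : 1 <= 3 ^ q) by (apply pow_R1_Rle; lra).
  generalize (Cmod_ge_0 c). intros Hc.
  assert (G : forall k, r + INR k <= Cmod (z (j + k)%nat)).
  { induction k as [|k IH].
    - rewrite Nat.add_0_r. simpl. lra.
    - assert (E := corr_escape p q c (z (j + k)%nat) (z (S (j + k))) Hq Hpq).
      generalize (pos_INR k). intros Hk.
      rewrite S_INR. replace (j + S k)%nat with (S (j + k)) by lia.
      specialize (E ltac:(lra) (Hz _)). lra. }
  destruct (nfloor_ex (Rmax 0 M)) as [n Hn]; [apply Rmax_l|].
  specialize (G (S n)). specialize (HM (j + S n)%nat). rewrite S_INR in G.
  generalize (Rmax_r 0 M). lra.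
Qed.

(** Because of the error [e], the points having such pseudo-orbits of every length
    form a set that contains the [e]-neighbourhood of its own preimage. *)
Fixpoint pseudo_orbit (p q : nat) (r e : R) (c : C) (N : nat) (z : C) : Prop :=
  Cmod z <= r /\
  match N with
  | O => True
  | S N' => exists z' w, Cmod (z' - z) <= e /\ corr p q c z' w /\ pseudo_orbit p q r e c N' w
  end.

Lemma pseudo_orbit_norm (p q : nat) (r e : R) (c : C) (N : nat) (z : C) :
  pseudo_orbit p q r e c N z -> Cmod z <= r.
Proof. destruct N; simpl; tauto. Qed.

Lemma pseudo_orbit_le (p q : nat) (r e e' : R) (c : C) (N N' : nat) (z : C) :
  e' <= e -> (N <= N')%nat -> pseudo_orbit p q r e' c N' z -> pseudo_orbit p q r e c N z.
Proof.
  intros He. revert N z. induction N' as [|N' IH]; intros N z HN H.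
  - replace N with O by lia. exact H.
  - destruct H as [H1 [z' [w [H2 [H3 H4]]]]]. destruct N as [|N]; [now split|].
    split; auto. exists z', w. split; [lra|]. split; auto. apply IH; auto. lia.
Qed.

Lemma filled_julia_pseudo_orbit (p q : nat) (r e : R) (c z : C) (N : nat) :
  (0 < q)%nat -> (q < p)%nat -> 3 ^ q + Cmod c <= r -> 0 <= e ->
  filled_julia p q c z -> pseudo_orbit p q r e c N z.
Proof.
  intros Hq Hpq Hr He [u Hu]. assert (Hb := orbit_bound p q c z u r Hq Hpq Hr Hu).
  destruct Hu as [<- [Hu _]]. generalize O. induction N as [|N IH]; intros j.
  - split; auto.
  - split; auto. exists (u j), (u (S j)). rewrite Cmod_sub_diag. auto.
Qed.

(** Letting the parameter vary as well makes one compactness argument yield both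
    the closedness of [K_c] and its upper semicontinuity in [c]. *)
Definition pseudo_recurrent (p q : nat) (r : R) (c z : C) : Prop :=
  forall d N, 0 < d ->
    exists c' z', Cmod (c' - c) <= d /\ Cmod (z' - z) <= d /\ pseudo_orbit p q r d c' N z'.

Lemma not_corr_near (p q : nat) (c z w : C) :
  ~ corr p q c z w -> exists d, 0 < d /\
    forall c' z' w', Cmod (c' - c) <= d -> Cmod (z' - z) <= d -> Cmod (w' - w) <= d ->
      ~ corr p q c' z' w'.
Proof.
  intros H. unfold corr in *. apply Cmod_sub_pos in H.
  set (e := Cmod ((w - c) ^ q - z ^ p)) in *.
  destruct (sderiv_cont _ _ _ (sderiv_pow q (w - c)) (e / 2)) as [d1 [Hd1 H1]]; [lra|].
  destruct (sderiv_cont _ _ _ (sderiv_pow p z) (e / 2)) as [d2 [Hd2 H2]]; [lra|].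
  exists (Rmin (d1 / 3) (d2 / 2)). split; [apply Rmin_pos; lra|].
  intros c' z' w' Hc Hz Hw E.
  generalize (Rmin_l (d1 / 3) (d2 / 2)) (Rmin_r (d1 / 3) (d2 / 2)). intros.
  assert (A1 : Cmod (w' - c' - (w - c)) < d1).
  { replace (w' - c' - (w - c))%C with (w' - w - (c' - c))%C by ring.
    eapply Rle_lt_trans; [apply Cmod_sub_le|]. lra. }
  apply H1 in A1. assert (A2 := H2 z' ltac:(lra)). rewrite E in A1.
  assert (T := Cmod_sub_triangle (z' ^ p) ((w - c) ^ q) (z ^ p)).
  rewrite (Cmod_sub_sym _ (z' ^ p)) in T. fold e in T. lra.
Qed.

(** Compactness in [w]: a point that is not an image of [z], or is not pseudo-recurrent, has a
    neighbourhood without long pseudo-orbits issuing from images; the other points are interior to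
    [V]. The condition [/ d <= INR N] ties the length to [d], so that one gauge suffices, and
    [2 * d] leaves room for one pseudo-orbit error on top of the displacement of [z]. *)
Lemma image_near (p q : nat) (r : R) (c z : C) (V : C -> Prop) :
  (forall w, corr p q c z w -> pseudo_recurrent p q r c w ->
     exists d, 0 < d /\ forall w', Cmod (w' - w) < d -> V w') ->
  exists d, 0 < d /\ forall c' z' w N,
    Cmod (c' - c) <= d -> Cmod (z' - z) <= 2 * d -> corr p q c' z' w ->
    / d <= INR N -> pseudo_orbit p q r d c' N w -> V w.
Proof.
  intros HV.
  destruct (compact_gauge r (fun d w => 0 < d -> forall c' z' N, Cmod (c' - c) <= d ->
    Cmod (z' - z) <= 2 * d -> corr p q c' z' w -> / d <= INR N ->
    pseudo_orbit p q r d c' N w -> V w)) as [d [Hd H]].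
  - intros d d' w Hdd H Hd' c' z' N H1 H2 H3 H4 H5. apply (H ltac:(lra) c' z' N); auto; try lra.
    + apply Rle_trans with (/ d'); auto. apply Rinv_le_contravar; auto.
    + eapply pseudo_orbit_le; [apply Hdd|apply le_n|auto].
  - intros w Hw. destruct (classic (corr p q c z w)) as [Hc|Hc].
    + destruct (classic (pseudo_recurrent p q r c w)) as [Hp|Hp].
      * destruct (HV w Hc Hp) as [d [Hd H]]. exists d. split; auto.
      * apply not_all_ex_not in Hp. destruct Hp as [d Hp].
        apply not_all_ex_not in Hp. destruct Hp as [N Hp].
        apply imply_to_and in Hp. destruct Hp as [Hd Hp].
        generalize (pos_INR N). intros HN.
        assert (Hi : 0 < / (INR N + 1)) by (apply Rinv_0_lt_compat; lra).
        exists (Rmin d (/ (INR N + 1))). split; [apply Rmin_pos; auto|].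
        generalize (Rmin_l d (/ (INR N + 1))) (Rmin_r d (/ (INR N + 1))).
        set (d' := Rmin _ _). intros Hl Hr w' Hw' Hd' c' z' N' H1 H2 H3 H4 H5.
        exfalso. apply Hp. exists c', w'. split; [lra|]. split; [lra|].
        eapply pseudo_orbit_le; [apply Hl| |apply H5].
        apply INR_le. apply Rle_trans with (INR N + 1); [lra|].
        apply Rle_trans with (/ d'); auto.
        rewrite <- (Rinv_inv (INR N + 1)). apply Rinv_le_contravar; auto.
    + destruct (not_corr_near p q c z w Hc) as [d [Hd H]].
      exists (d / 2). split; [lra|]. intros w' Hw' _ c' z' N H1 H2 H3.
      exfalso. revert H3. apply H; lra.
  - exists d. split; auto. intros c' z' w N H1 H2 H3 H4 H5.
    apply (H w (pseudo_orbit_norm _ _ _ _ _ _ _ H5) Hd c' z' N); auto.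
Qed.

(** The case of empty [V] in [image_near]: without a recurrent image, no long pseudo-orbit could
    start near [z]. *)
Lemma pseudo_recurrent_step (p q : nat) (r : R) (c z : C) :
  pseudo_recurrent p q r c z -> exists w, corr p q c z w /\ pseudo_recurrent p q r c w.
Proof.
  intros Hz. apply NNPP. intros Hn.
  destruct (image_near p q r c z (fun _ => False)) as [d [Hd H]].
  { intros w H1 H2. exfalso. apply Hn. eauto. }
  destruct (nfloor_ex (/ d)) as [N HN]; [apply Rlt_le, Rinv_0_lt_compat; auto|].
  (* One step is spent on reaching [w], and the remaining length [S N] still exceeds [/ d]. *)
  destruct (Hz d (S (S N)) Hd) as [c' [z' [H1 [H2 [_ [z'' [w [H3 [H4 H5]]]]]]]]].
  apply (H c' z'' w (S N)); auto.
  - eapply Rle_trans; [apply (Cmod_sub_triangle z')|]. lra.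
  - rewrite S_INR. lra.
Qed.

Lemma pseudo_recurrent_norm (p q : nat) (r : R) (c z : C) :
  pseudo_recurrent p q r c z -> Cmod z <= r.
Proof.
  intros H. apply Rle_plus_epsilon. intros e He.
  destruct (H e O He) as [c' [z' [_ [H1 [H2 _]]]]].
  assert (E := Cmod_le_sub z z'). rewrite Cmod_sub_sym in E. lra.
Qed.

Lemma pseudo_recurrent_filled_julia (p q : nat) (r : R) (c z : C) :
  pseudo_recurrent p q r c z -> filled_julia p q c z.
Proof.
  intros Hz.
  destruct (choice (fun u w => pseudo_recurrent p q r c u ->
              corr p q c u w /\ pseudo_recurrent p q r c w)) as [F HF].
  { intros u. destruct (classic (pseudo_recurrent p q r c u)) as [Hu|Hu].
    - destruct (pseudo_recurrent_step _ _ _ _ _ Hu) as [w Hw]. exists w. auto.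
    - exists 0%C. tauto. }
  assert (Hi : forall j, pseudo_recurrent p q r c (Nat.iter j F z)).
  { induction j as [|j IH]; auto. now apply HF. }
  exists (fun j => Nat.iter j F z). split; [reflexivity|]. split.
  - intros j. now apply (HF _ (Hi j)).
  - apply bounded_seq_iff. exists r. intros j. eapply pseudo_recurrent_norm, Hi.
Qed.

(** A limit of points of [K_c] is pseudo-recurrent, since the approximating points have exact orbits
    for the same parameter. *)
Lemma closed_filled_julia (p q : nat) (c : C) :
  (0 < q)%nat -> (q < p)%nat -> closed (filled_julia p q c).
Proof.
  intros Hq Hpq x Hx. apply (pseudo_recurrent_filled_julia p q (3 ^ q + Cmod c)).
  intros d N Hd. apply NNPP. intros Hn. apply Hx, locally_Cmod. exists d. split; auto.
  intros y Hy Ky. apply Hn. exists c, y. rewrite Cmod_sub_diag. repeat split; try lra.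
  apply filled_julia_pseudo_orbit; auto; lra.
Qed.

Lemma filled_julia_backward (p q : nat) (c z w : C) :
  corr p q c z w -> filled_julia p q c w -> filled_julia p q c z.
Proof.
  intros H [u [H1 [H2 H3]]].
  exists (fun j => match j with O => z | S j => u j end). split; [reflexivity|]. split.
  - intros [|j]; auto. now rewrite H1.
  - apply bounded_seq_iff in H3. destruct H3 as [M HM]. apply bounded_seq_iff.
    exists (Rmax (Cmod z) M). intros [|j]; [apply Rmax_l|].
    eapply Rle_trans; [apply HM|apply Rmax_r].
Qed.

Lemma filled_julia_forward (p q : nat) (c z : C) :
  filled_julia p q c z -> exists w, corr p q c z w /\ filled_julia p q c w.
Proof.
  intros [u [H1 [H2 H3]]]. exists (u 1%nat). rewrite <- H1. split; auto.
  exists (fun j => u (S j)). split; auto. split; auto.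
  apply bounded_seq_iff in H3. destruct H3 as [M HM]. apply bounded_seq_iff. eauto.
Qed.

(** * Cauchy's estimate *)

Fixpoint csum (u : nat -> C) (N : nat) : C :=
  match N with O => RtoC 0 | S N' => (csum u N' + u N')%C end.

Lemma csum_close (u : nat -> C) (b : C) (g : R) (N : nat) :
  (forall k, Cmod (u k - b) <= g) -> Cmod (csum u N - INR N * b) <= INR N * g.
Proof.
  intros H. induction N as [|N IH].
  - simpl. replace (0 - 0 * b)%C with (RtoC 0) by ring. rewrite Cmod_0. lra.
  - rewrite S_INR. simpl csum. rewrite RtoC_plus.
    eapply Rle_trans; [apply (Cmod_le_add _ (csum u N - INR N * b) (u N - b)); ring|].
    specialize (H N). lra.
Qed.

Lemma Cmod_rotation (h : R) : Cmod (cos h, sin h) = 1.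
Proof.
  unfold Cmod. simpl. rewrite !Rmult_1_r.
  replace (cos h * cos h + sin h * sin h) with 1; [apply sqrt_1|].
  generalize (sin2_cos2 h). unfold Rsqr. lra.
Qed.

Lemma rotation_pow (h : R) (k : nat) :
  ((cos h, sin h) ^ k)%C = (cos (INR k * h), sin (INR k * h)).
Proof.
  induction k as [|k IH].
  - simpl. rewrite Rmult_0_l, cos_0, sin_0. reflexivity.
  - rewrite Cpow_S, IH, S_INR.
    replace ((INR k + 1) * h) with (h + INR k * h) by ring.
    rewrite cos_plus, sin_plus. apply injective_projections; simpl; ring.
Qed.

(** The mean of [F] over the [N]-th roots of unity times [w]; it is nearly
    unchanged when [w] is replaced by [w * tau], since [tau - 1 = - i (zeta - 1)]
    and the increments along the circle telescope. *)
Lemma circle_sum_step (F : C -> C) (zeta w : C) (N : nat) (e : R) :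
  (forall k, Cmod (F (w * zeta ^ k * (1 - Ci * (zeta - 1)))%C - F (w * zeta ^ k)%C
                   + Ci * (F (w * zeta ^ S k)%C - F (w * zeta ^ k)%C)) <= e) ->
  (zeta ^ N = 1)%C ->
  Cmod (csum (fun k => F (w * (1 - Ci * (zeta - 1)) * zeta ^ k)%C) N
        - csum (fun k => F (w * zeta ^ k)%C) N) <= INR N * e.
Proof.
  intros He HN.
  set (tau := (1 - Ci * (zeta - 1))%C) in *.
  set (T1 := csum (fun k => F (w * tau * zeta ^ k)%C)).
  set (T0 := csum (fun k => F (w * zeta ^ k)%C)).
  assert (G : forall n, Cmod (T1 n - T0 n + Ci * (F (w * zeta ^ n)%C - F w)) <= INR n * e).
  { induction n as [|n IH].
    - simpl. replace (w * 1)%C with w by ring.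
      change (T1 O) with (RtoC 0). change (T0 O) with (RtoC 0).
      replace (0 - 0 + Ci * (F w - F w))%C with (RtoC 0) by ring. rewrite Cmod_0. lra.
    - rewrite S_INR. unfold T1, T0. simpl csum. fold T1. fold T0.
      specialize (He n).
      replace (w * tau * zeta ^ n)%C with (w * zeta ^ n * tau)%C by ring.
      eapply Rle_trans; [apply (Cmod_le_add _ (T1 n - T0 n + Ci * (F (w * zeta ^ n)%C - F w))
        (F (w * zeta ^ n * tau)%C - F (w * zeta ^ n)%C + Ci * (F (w * zeta ^ S n)%C - F (w * zeta ^ n)%C))); ring|].
      lra. }
  specialize (G N). rewrite HN in G. replace (w * 1)%C with w in G by ring.
  replace (T1 N - T0 N)%C with (T1 N - T0 N + Ci * (F w - F w))%C by ring. exact G.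
Qed.

Lemma uniform_sderiv (F : C -> C) (rho e : R) :
  0 < e -> (forall w, rho <= Cmod w <= 1 -> exists al, sderiv F w al) ->
  exists d, 0 < d /\ forall w, rho <= Cmod w <= 1 -> exists al,
    forall y y', Cmod (y - w) <= d -> Cmod (y' - w) <= d ->
      Cmod (F y - F y' - al * (y - y')) <= e * Cmod (y - y').
Proof.
  intros He HF.
  destruct (compact_gauge 1 (fun d w => rho <= Cmod w -> exists al,
    forall y y', Cmod (y - w) <= d -> Cmod (y' - w) <= d ->
      Cmod (F y - F y' - al * (y - y')) <= e * Cmod (y - y'))) as [d [Hd H]].
  - intros d d' w Hdd H Hw. destruct (H Hw) as [al Hal]. exists al.
    intros y y' Hy Hy'. apply Hal; lra.
  - intros w Hw. destruct (Rle_lt_dec rho (Cmod w)) as [h|h].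
    + destruct (HF w (conj h Hw)) as [al [M [d [HM [Hd H]]]]].
      assert (Hi : 0 < e / (4 * (M + 1))) by (apply Rdiv_lt_0_compat; lra).
      set (d' := Rmin (d / 2) (e / (4 * (M + 1)))).
      assert (Hd' : 0 < d') by (apply Rmin_pos; lra).
      assert (Hl : d' <= d / 2) by apply Rmin_l.
      assert (Hr : d' <= e / (4 * (M + 1))) by apply Rmin_r.
      apply Rle_div_r in Hr; [|lra].
      exists d'. split; auto. intros w' Hw' _. exists al. intros y y' Hy Hy'.
      assert (A1 := Cmod_sub_triangle w' y w). assert (A2 := Cmod_sub_triangle w' y' w).
      eapply Rle_trans; [apply H; lra|].
      apply Rmult_le_compat_r; [apply Cmod_ge_0|].
      apply Rle_trans with (M * (4 * d')); [apply Rmult_le_compat_l; lra|]. nra.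
    + exists (rho - Cmod w). split; [lra|]. intros w' Hw' Hr.
      assert (E := Cmod_le_sub w' w). lra.
  - exists d. split; auto. intros w [H1 H2]. auto.
Qed.

(** For [zeta = exp (i h)] the real part of [1 - Ci * (zeta - 1)] is [1 + sin h], so [s = sin h]
    measures the radial growth per step. As [Cmod (zeta - 1) <= 2 * s], error and growth per step
    are comparable, and the total error does not depend on the number of steps. *)
Lemma small_rotation (d : R) :
  0 < d -> exists zeta N s, (0 < N)%nat /\ (zeta ^ N = 1)%C /\ Cmod zeta = 1 /\
    0 < s <= 1 /\ Cmod (zeta - 1) <= 2 * s /\ Cmod (zeta - 1) <= d /\
    1 + s <= Cmod (1 - Ci * (zeta - 1)).
Proof.
  intros Hd. assert (Hpi := PI_RGT_0). assert (Hpi4 := PI_4).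
  assert (Hpi2 := PI2_1).
  assert (H0 : 0 <= 2 * PI / Rmin 1 (d / 2)).
  { apply Rdiv_le_0_compat; [lra|]. apply Rmin_pos; lra. }
  destruct (nfloor_ex _ H0) as [N' HN'].
  set (h := 2 * PI / INR (S N')).
  assert (HS : 0 < INR (S N')) by (apply lt_0_INR; lia).
  assert (Hh0 : 0 < h) by (apply Rdiv_lt_0_compat; lra).
  assert (Hmin : 0 < Rmin 1 (d / 2)) by (apply Rmin_pos; lra).
  assert (Hh : h <= Rmin 1 (d / 2)).
  { unfold h. apply Rle_div_l; auto. destruct HN' as [_ HN']. rewrite <- S_INR in HN'.
    apply Rlt_div_l in HN'; lra. }
  assert (Hh1 : h <= 1) by (eapply Rle_trans; [apply Hh|apply Rmin_l]).
  assert (Hhd : h <= d / 2) by (eapply Rle_trans; [apply Hh|apply Rmin_r]).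
  assert (Hs : 0 < sin h) by (apply sin_gt_0; lra).
  assert (Hc : 0 <= cos h) by (apply cos_ge_0; lra).
  assert (Hsh : sin h < h) by (apply sin_lt_x; auto).
  assert (E2 := sin2_cos2 h). unfold Rsqr in E2.
  assert (Hc1 : cos h <= 1) by apply COS_bound.
  assert (B : Cmod ((cos h, sin h) - 1) <= 2 * sin h).
  { apply Rle_trans with (Cmod (RtoC (cos h - 1)) + Cmod (Ci * RtoC (sin h))).
    - apply Cmod_le_add. apply injective_projections; simpl; ring.
    - rewrite Cmod_mult, Cmod_Ci, !Cmod_R, Rabs_left1, Rabs_pos_eq by lra.
      nra. }
  exists (cos h, sin h), (S N'), (sin h).
  split; [lia|]. split.
  { rewrite rotation_pow. replace (INR (S N') * h) with (2 * PI).
    - rewrite cos_2PI, sin_2PI. reflexivity.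
    - unfold h. field. lra. }
  split; [apply Cmod_rotation|]. split; [lra|]. split; auto. split; [lra|].
  eapply Rle_trans; [|apply re_le_Cmod]. simpl. rewrite Rabs_pos_eq; lra.
Qed.

(** Cauchy's estimate, by sliding the circle means of [(phi w - phi 0) / w]
    from radius near [0] to radius near [1/2]. *)
Lemma cauchy_estimate (phi : C -> C) (b : C) (r : R) :
  (forall w, Cmod w <= 1 -> exists al, sderiv phi w al) ->
  (forall w, Cmod w <= 1 -> Cmod (phi w) <= r) ->
  sderiv phi 0 b -> Cmod b <= 4 * r.
Proof.
  intros Hphi Hb H0.
  destruct (Rle_lt_dec (Cmod b) (4 * r)) as [|gap]; auto. exfalso.
  set (F := fun w => ((phi w - phi 0) * / w)%C).
  set (g := (Cmod b - 4 * r) / 4). assert (Hg : 0 < g) by (unfold g; lra).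
  assert (Hr : 0 <= r).
  { eapply Rle_trans; [apply Cmod_ge_0|apply (Hb 0%C)]. rewrite Cmod_0. lra. }
  assert (FD : forall w, 0 < Cmod w <= 1 -> exists al, sderiv F w al).
  { intros w [Hw1 Hw2]. destruct (Hphi w Hw2) as [al Hal].
    assert (Hw0 : w <> 0%C) by (now apply Cmod_gt_0).
    destruct (sderiv_inv w Hw0) as [be Hbe].
    assert (D := sderiv_plus _ _ _ _ _ Hal (sderiv_const (- phi 0)%C w)).
    eexists. apply (sderiv_mult _ _ _ _ _ D Hbe). }
  assert (FB : forall w, / 2 <= Cmod w <= 1 -> Cmod (F w) <= 4 * r).
  { intros w [Hw1 Hw2]. unfold F. rewrite Cmod_mult, Cmod_inv by (apply Cmod_gt_0; lra).
    assert (A := Hb w Hw2). assert (A0 := Hb 0%C ltac:(rewrite Cmod_0; lra)).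
    assert (A1 := Cmod_sub_le (phi w) (phi 0)).
    replace (4 * r) with (2 * r * / / 2) by field.
    apply Rmult_le_compat; [apply Cmod_ge_0|apply Rlt_le, Rinv_0_lt_compat; lra|lra|].
    apply Rinv_le_contravar; lra. }
  assert (F0 : exists rho, 0 < rho < / 2 /\ forall w, Cmod w = rho -> Cmod (F w - b) <= g).
  { destruct H0 as [M [d [HM [Hd H]]]].
    assert (Hi : 0 < g / (M + 1)) by (apply Rdiv_lt_0_compat; lra).
    set (v := Rmin (Rmin d (/ 2)) (g / (M + 1))).
    assert (Hv : 0 < v) by (repeat apply Rmin_pos; lra).
    assert (v <= d) by (eapply Rle_trans; [apply Rmin_l|apply Rmin_l]).
    assert (v <= / 2) by (eapply Rle_trans; [apply Rmin_l|apply Rmin_r]).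
    assert (Hvg : v <= g / (M + 1)) by apply Rmin_r.
    apply Rle_div_r in Hvg; [|lra].
    exists (v / 2). split; [lra|]. intros w Hw.
    assert (Hw0 : w <> 0%C) by (apply Cmod_gt_0; lra).
    assert (E : (w - 0)%C = w) by ring.
    specialize (H w 0%C). rewrite Cmod_sub_diag, E, Hw in H.
    specialize (H ltac:(lra) ltac:(lra)).
    replace (F w - b)%C with ((phi w - phi 0 - b * w) / w)%C by (unfold F; field; auto).
    rewrite Cmod_div, Hw by auto. apply Rle_div_l; [lra|].
    eapply Rle_trans; [apply H|]. nra. }
  destruct F0 as [rho [[Hrho1 Hrho2] F0]].
  (* After [m] steps the radius is at least [rho * (1 + m * s)], so [m * s] need only pass
     [/ (2 * rho)]; the [1] pays for rounding up. The errors [2 * e * eta] then add up to at most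
     [4 * e * A = g]. *)
  set (A := / (2 * rho) + 1). assert (HA : 0 < A).
  { unfold A. assert (0 < / (2 * rho)) by (apply Rinv_0_lt_compat; lra). lra. }
  set (e := g / (4 * A)). assert (He : 0 < e) by (apply Rdiv_lt_0_compat; lra).
  destruct (uniform_sderiv F rho e He) as [d [Hd HU]].
  { intros w Hw. apply FD. lra. }
  destruct (small_rotation (Rmin d 1)) as [zeta [N [s [HN [HzN [Hz1 [Hs [Hzs [Hzd Htau]]]]]]]]].
  { apply Rmin_pos; lra. }
  assert (Hzd1 : Cmod (zeta - 1) <= d) by (eapply Rle_trans; [apply Hzd|apply Rmin_l]).
  assert (Hzd2 : Cmod (zeta - 1) <= 1) by (eapply Rle_trans; [apply Hzd|apply Rmin_r]).
  set (eta := Cmod (zeta - 1)) in *.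
  assert (Heta : 0 <= eta) by apply Cmod_ge_0.
  set (tau := (1 - Ci * (zeta - 1))%C) in *.
  assert (Htau1 : Cmod tau <= 1 + eta).
  { unfold tau. eapply Rle_trans; [apply Cmod_sub_le|].
    rewrite Cmod_1, Cmod_mult, Cmod_Ci. fold eta. lra. }
  assert (Hzk : forall w k, Cmod (w * zeta ^ k) = Cmod w).
  { intros w k. rewrite Cmod_mult, Cmod_pow, Hz1, pow1. ring. }
  set (T := fun w => csum (fun k => F (w * zeta ^ k)%C) N).
  assert (HNp : 0 < INR N) by (now apply lt_0_INR).
  assert (Step : forall w, rho <= Cmod w <= 1 -> Cmod (T (w * tau)%C - T w) <= INR N * (2 * e * eta)).
  { intros w Hw. apply circle_sum_step; auto. fold tau. intros k.
    rewrite (Cpow_S zeta).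
    set (y := (w * zeta ^ k)%C). assert (Hy : Cmod y = Cmod w) by apply Hzk.
    replace (w * (zeta * zeta ^ k))%C with (y * zeta)%C by (unfold y; ring).
    destruct (HU y) as [al Hal]; [lra|].
    assert (E1 : Cmod (y * tau - y) = Cmod y * eta).
    { unfold tau. replace (y * (1 - Ci * (zeta - 1)) - y)%C with (- (Ci * (y * (zeta - 1))))%C by ring.
      rewrite Cmod_opp, !Cmod_mult, Cmod_Ci. fold eta. ring. }
    assert (E2 : Cmod (y * zeta - y) = Cmod y * eta).
    { replace (y * zeta - y)%C with (y * (zeta - 1))%C by ring. rewrite Cmod_mult. reflexivity. }
    assert (Cmod y * eta <= eta) by (rewrite <- (Rmult_1_l eta) at 2; apply Rmult_le_compat_r; lra).
    assert (B1 := Hal (y * tau)%C y ltac:(lra) ltac:(rewrite Cmod_sub_diag; lra)).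
    assert (B2 := Hal (y * zeta)%C y ltac:(lra) ltac:(rewrite Cmod_sub_diag; lra)).
    eapply Rle_trans.
    - apply (Cmod_le_add _ (F (y * tau)%C - F y - al * (y * tau - y))
        (Ci * (F (y * zeta)%C - F y - al * (y * zeta - y)))).
      assert (E3 : (y * tau - y + Ci * (y * zeta - y))%C = 0) by (unfold tau; ring).
      transitivity (F (y * tau)%C - F y + Ci * (F (y * zeta)%C - F y)
                    - al * (y * tau - y + Ci * (y * zeta - y)))%C; [rewrite E3; ring|ring].
    - rewrite Cmod_mult, Cmod_Ci. rewrite E1 in B1. rewrite E2 in B2.
      assert (e * (Cmod y * eta) <= e * eta) by (apply Rmult_le_compat_l; lra). lra. }
  set (bnd := INR N * (2 * e * eta)) in *.
  assert (Hbnd : 0 <= bnd) 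
    by (unfold bnd; assert (0 <= e * eta) by (apply Rmult_le_pos; lra); apply Rmult_le_pos; lra).
  assert (March : forall m,
    (exists w, / 2 <= Cmod w <= 1 /\ Cmod (T w - T rho) <= INR m * bnd) \/
    (rho * (1 + INR m * s) <= Cmod (rho * tau ^ m) < / 2 /\
     Cmod (T (rho * tau ^ m)%C - T rho) <= INR m * bnd)).
  { assert (Hrp : 0 <= Cmod tau - 1) by lra.
    induction m as [|m [[w [W1 W2]]|[[W1 W3] W2]]].
    - right. simpl. replace (rho * 1)%C with (RtoC rho) by ring.
      rewrite Cmod_sub_diag, Cmod_R, Rabs_pos_eq by lra. lra.
    - left. exists w. split; auto. rewrite S_INR. lra.
    - set (w := (rho * tau ^ m)%C) in *.
      assert (Ew : (rho * tau ^ S m)%C = (w * tau)%C) by (unfold w; simpl; ring).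
      rewrite Ew, S_INR.
      assert (Hms : 0 <= INR m * s) by (apply Rmult_le_pos; [apply pos_INR|lra]).
      assert (Hrw : rho <= Cmod w).
      { eapply Rle_trans; [|apply W1]. rewrite <- (Rmult_1_r rho) at 1.
        apply Rmult_le_compat_l; lra. }
      assert (B : Cmod (T (w * tau)%C - T rho) <= (INR m + 1) * bnd).
      { eapply Rle_trans; [apply (Cmod_sub_triangle (T w))|].
        assert (S1 := Step w ltac:(lra)). lra. }
      assert (Et : Cmod (w * tau) = Cmod w * Cmod tau) by apply Cmod_mult.
      assert (Lo : rho * (1 + (INR m + 1) * s) <= Cmod (w * tau)).
      { rewrite Et. assert (Cmod w * (1 + s) <= Cmod w * Cmod tau)
          by (apply Rmult_le_compat_l; [apply Cmod_ge_0|auto]).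
        assert (rho * s <= Cmod w * s) by (apply Rmult_le_compat_r; lra). lra. }
      destruct (Rle_lt_dec (/ 2) (Cmod (w * tau))) as [h|h].
      + left. exists (w * tau)%C. split; auto. split; auto.
        (* The first radius to reach [1 / 2] does not pass [1], because [eta <= 1] bounds [Cmod tau]
           by [2]. *)
        rewrite Et. replace 1 with (/ 2 * 2) by field.
        apply Rmult_le_compat; try apply Cmod_ge_0; lra.
      + right. split; auto. }
  assert (Hi0 : 0 <= / (2 * rho) / s).
  { apply Rdiv_le_0_compat; [apply Rlt_le, Rinv_0_lt_compat|]; lra. }
  destruct (nfloor_ex _ Hi0) as [m [Hm1 Hm2]].
  apply Rle_div_r in Hm1; [|lra].
  apply Rlt_div_l in Hm2; [|lra].
  destruct (March (S m)) as [[w [W1 W2]]|[[W1 W3] _]]; rewrite S_INR in *.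
  - assert (Q : (INR m + 1) * bnd <= INR N * g).
    { unfold bnd. assert ((INR m + 1) * s <= A) by (unfold A; lra).
      assert ((INR m + 1) * eta <= (INR m + 1) * (2 * s))
        by (apply Rmult_le_compat_l; [generalize (pos_INR m)|]; lra).
      assert (Ee : 4 * e * A = g) by (unfold e; field; lra).
      replace ((INR m + 1) * (INR N * (2 * e * eta))) with (INR N * (2 * e * ((INR m + 1) * eta))) by ring.
      apply Rmult_le_compat_l; [lra|]. rewrite <- Ee.
      apply Rle_trans with (2 * e * (2 * A)); [|lra]. apply Rmult_le_compat_l; lra. }
    assert (C1 : Cmod (T w - INR N * 0) <= INR N * (4 * r)).
    { apply csum_close. intros k. replace (F (w * zeta ^ k)%C - 0)%C with (F (w * zeta ^ k)%C) by ring.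
      apply FB. rewrite Hzk. auto. }
    assert (C2 : Cmod (T rho - INR N * b) <= INR N * g).
    { apply csum_close. intros k. apply F0. rewrite Hzk, Cmod_R, Rabs_pos_eq; lra. }
    replace (T w - INR N * 0)%C with (T w) in C1 by ring.
    assert (C3 : Cmod (INR N * b) <= Cmod (T w) + (Cmod (T w - T rho) + Cmod (T rho - INR N * b))).
    { eapply Rle_trans.
      { apply (Cmod_le_add _ (T w) (- (T w - T rho + (T rho - INR N * b)))). ring. }
      rewrite Cmod_opp.
      apply Rplus_le_compat_l, Cmod_triangle. }
    rewrite Cmod_mult, Cmod_R, Rabs_pos_eq in C3 by lra.
    assert (INR N * Cmod b <= INR N * (4 * r + g + g)) by lra.
    apply Rmult_le_reg_l in H; auto. unfold g in H. lra.
  - assert (Hx : rho * (/ (2 * rho)) = / 2) by (field; lra).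
    assert (rho * (/ (2 * rho)) <= rho * ((INR m + 1) * s)) by (apply Rmult_le_compat_l; lra).
    lra.
Qed.

(** * The cycle is repelling *)

Definition sdiff (f : C -> C) (x : C) : Prop := exists al, sderiv f x al.

Lemma sdiff_mult (f g : C -> C) (x : C) :
  sdiff f x -> sdiff g x -> sdiff (fun w => f w * g w)%C x.
Proof. intros [al H] [be H']. eexists. apply (sderiv_mult _ _ _ _ _ H H'). Qed.

Lemma sdiff_plus (f g : C -> C) (x : C) :
  sdiff f x -> sdiff g x -> sdiff (fun w => f w + g w)%C x.
Proof. intros [al H] [be H']. eexists. apply (sderiv_plus _ _ _ _ _ H H'). Qed.

Lemma sdiff_comp (f g : C -> C) (x : C) :
  sdiff f x -> sdiff g (f x) -> sdiff (fun w => g (f w)) x.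
Proof. intros [al H] [be H']. eexists. apply (sderiv_comp _ _ _ _ _ H H'). Qed.

Lemma RtoC_INR_neq_0 (k : nat) : (0 < k)%nat -> RtoC (INR k) <> 0%C.
Proof. intros Hk E. apply RtoC_inj in E. now apply (not_0_INR k ltac:(lia)). Qed.

(** * Roots of zero-free functions on the disc *)

Lemma local_root (p : nat) :
  (0 < p)%nat -> exists (g : C -> C) d, 0 < d <= 1 /\ g 1%C = 1%C /\
    forall t, Cmod (t - 1) < d -> (g t ^ p = t)%C /\ sdiff g t.
Proof.
  intros Hp.
  assert (D := sderiv_pow p 1).
  assert (E1 : forall k, (1 ^ k = 1)%C) by apply Cpow_1_l.
  assert (Hal : (INR p * 1 ^ (p - 1) <> 0)%C).
  { rewrite E1, Cmult_1_r. now apply RtoC_INR_neq_0. }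
  destruct (sderiv_inverse _ _ _ 1 D Hal ltac:(lra))
    as [g [rho [d [_ [Hd [G1 [G2 [_ G3]]]]]]]].
  rewrite !E1 in *.
  set (al := (INR p * 1)%C) in *.
  assert (Hm : 0 < Cmod al) by now apply Cmod_gt_0.
  (* Radius at most [1] keeps [t], hence [g t], away from [0], where the power map is critical. *)
  exists g, (Rmin d 1).
  assert (Hmin : 0 < Rmin d 1) by (apply Rmin_pos; lra).
  split; [split; [auto|apply Rmin_r]|]. split; auto.
  assert (Hl : Rmin d 1 <= d) by apply Rmin_l. assert (Hr : Rmin d 1 <= 1) by apply Rmin_r.
  intros t Ht. destruct (G2 t ltac:(lra)) as [_ Et]. split; auto.
  assert (Hg0 : g t <> 0%C).
  { intros E. rewrite E, Cpow_0_l in Et by auto. rewrite <- Et in Ht.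
    rewrite Cmod_sub_sym in Ht. replace (1 - 0)%C with (RtoC 1) in Ht by ring.
    rewrite Cmod_1 in Ht. lra. }
  eexists. apply (sderiv_implicit (fun w => w) (fun w => w ^ p)%C g t
                    (INR p * g t ^ (p - 1)) 1 (d - Cmod (t - 1))).
  - intros e He. exists (Rmin (d - Cmod (t - 1)) (e * (Cmod al / 2))).
    split; [apply Rmin_pos; nra|].
    intros y Hy. generalize (Rmin_l (d - Cmod (t - 1)) (e * (Cmod al / 2)))
      (Rmin_r (d - Cmod (t - 1)) (e * (Cmod al / 2))). intros.
    assert (T := Cmod_sub_triangle t y 1).
    eapply Rle_lt_trans; [apply G3; lra|].
    replace (2 / Cmod al * Cmod (y - t)) with (Cmod (y - t) / (Cmod al / 2)) by (field; lra).
    apply Rlt_div_l; lra.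
  - lra.
  - intros y Hy. apply G2. assert (T := Cmod_sub_triangle t y 1). lra.
  - apply sderiv_id.
  - apply sderiv_pow.
  - apply Cmult_neq_0; [now apply RtoC_INR_neq_0|now apply Cpow_nz].
Qed.

Lemma uniform_ratio (psi : C -> C) (d : R) :
  0 < d <= 1 -> (forall w, Cmod w <= 1 -> cont_at psi w) ->
  (forall w, Cmod w <= 1 -> psi w <> 0%C) ->
  exists e, 0 < e /\ forall w y, Cmod w <= 1 -> Cmod (y - w) <= e ->
    Cmod (psi y / psi w - 1) < d.
Proof.
  intros Hd Hc Hn.
  destruct (compact_gauge 1 (fun e w => 0 < e -> forall y, Cmod (y - w) <= e ->
     Cmod (psi y / psi w - 1) < d)) as [e [He H]].
  - intros e e' w Hee H He' y Hy. apply H; lra.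
  - intros w Hw. assert (Hm : 0 < Cmod (psi w)) by (apply Cmod_gt_0; auto).
    set (m := Cmod (psi w)) in *.
    destruct (Hc w Hw (m * d / 4)) as [e [He H]]; [nra|].
    exists (e / 2). split; [lra|]. intros w' Hw' _ y Hy.
    assert (A1 := H w' ltac:(lra)).
    assert (A2 := H y ltac:(assert (T := Cmod_sub_triangle w' y w); lra)).
    assert (A3 := Cmod_le_sub (psi w) (psi w')). rewrite Cmod_sub_sym in A3. fold m in A3.
    assert (A4 := Cmod_sub_triangle (psi w) (psi y) (psi w')).
    rewrite (Cmod_sub_sym (psi w) (psi w')) in A4.
    assert (Hmd : m * d <= m) by nra.
    assert (Hn' : psi w' <> 0%C) by (apply Cmod_gt_0; lra).
    replace (psi y / psi w' - 1)%C with ((psi y - psi w') / psi w')%C by (field; auto).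
    rewrite Cmod_div by auto. apply Rlt_div_l; [lra|].
    assert (d * (m / 2) < d * Cmod (psi w')) by (apply Rmult_lt_compat_l; lra). lra.
  - exists e. split; auto.
Qed.

(** The root is continued along each radius in [N] small steps, every one of which
    multiplies it by a root, near [1], of the ratio of consecutive values. *)
Lemma root_on_disc (p : nat) (psi : C -> C) (r0 : C) :
  (0 < p)%nat -> (forall w, Cmod w <= 1 -> sdiff psi w) ->
  (forall w, Cmod w <= 1 -> psi w <> 0%C) -> (r0 ^ p = psi 0)%C ->
  exists rt : C -> C, rt 0%C = r0 /\
    forall w, Cmod w <= 1 -> (rt w ^ p = psi w)%C /\ sdiff rt w.
Proof.
  intros Hp Hs Hn H0.
  destruct (local_root p Hp) as [g [d [Hd [G1 G2]]]].
  destruct (uniform_ratio psi d Hd) as [e [He HU]]; auto.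
  { intros w Hw. destruct (Hs w Hw) as [al Hal]. apply (sderiv_cont _ _ _ Hal). }
  destruct (nfloor_ex (/ e)) as [N' HN']; [apply Rlt_le, Rinv_0_lt_compat; auto|].
  rewrite <- S_INR in HN'. set (N := S N') in *.
  assert (HN : 0 < INR N) by (apply lt_0_INR; unfold N; lia).
  assert (HNe : / INR N <= e).
  { rewrite <- (Rinv_inv e). apply Rinv_le_contravar; [apply Rinv_0_lt_compat; auto|lra]. }
  set (t := fun i : nat => RtoC (INR i / INR N)).
  assert (Ht : forall i w, (i <= N)%nat -> Cmod w <= 1 -> Cmod (t i * w) <= 1).
  { intros i w Hi Hw. unfold t. rewrite Cmod_mult, Cmod_R.
    apply le_INR in Hi. assert (Hi0 := pos_INR i).
    assert (0 <= INR i / INR N) by (apply Rdiv_le_0_compat; lra).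
    assert (INR i / INR N <= 1) by (apply Rle_div_l; lra).
    rewrite Rabs_pos_eq by auto. generalize (Cmod_ge_0 w). nra. }
  (* Every [rt i] is a finite product of functions defined on the whole disc, so no local roots have
     to be glued. *)
  set (rt := fix rt i w := match i with O => r0
               | S i' => (rt i' w * g (psi (t (S i') * w) / psi (t i' * w)))%C end).
  assert (St : forall i w, (i <= N)%nat -> Cmod w <= 1 -> sdiff (fun w => psi (t i * w)%C) w).
  { intros i w Hi Hw. apply (sdiff_comp (fun w => t i * w)%C psi).
    - exists (t i). apply (sderiv_near_ext (fun w => t i * w + 0)%C _ _ _ 1); [lra| |apply sderiv_affine].
      intros. ring.
    - auto. }
  assert (K : forall i, (i <= N)%nat -> rt i 0%C = r0 /\
     forall w, Cmod w <= 1 -> (rt i w ^ p = psi (t i * w))%C /\ sdiff (rt i) w).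
  { induction i as [|i IH]; intros Hi.
    - split; [reflexivity|]. intros w Hw. split.
      + replace (t O * w)%C with (RtoC 0); [exact H0|].
        unfold t. change (INR 0) with 0. unfold Rdiv. rewrite Rmult_0_l. ring.
      + exists 0%C. apply sderiv_const.
    - destruct (IH ltac:(lia)) as [I1 I2].
      assert (E0 : forall i, (t i * 0 = 0)%C) by (intros; ring).
      split.
      + change (rt i 0%C * g (psi (t (S i) * 0) / psi (t i * 0)) = r0)%C.
        rewrite I1, !E0. replace (psi 0%C / psi 0%C)%C with (RtoC 1).
        * rewrite G1. ring.
        * field. apply Hn. rewrite Cmod_0. lra.
      + intros w Hw. destruct (I2 w Hw) as [J1 J2].
        assert (Hwi := Ht i w ltac:(lia) Hw).
        assert (Hr : Cmod (psi (t (S i) * w)%C / psi (t i * w)%C - 1) < d).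
        { apply HU; auto. replace (t (S i) * w - t i * w)%C with (RtoC (/ INR N) * w)%C.
          - assert (0 < / INR N) by (apply Rinv_0_lt_compat; auto).
            rewrite Cmod_mult, Cmod_R, Rabs_pos_eq by lra.
            generalize (Cmod_ge_0 w). nra.
          - unfold t. rewrite S_INR. unfold Rdiv.
            rewrite !RtoC_mult, RtoC_plus. ring. }
        destruct (G2 _ Hr) as [G3 G4]. split.
        * change ((rt i w * g (psi (t (S i) * w) / psi (t i * w))) ^ p = psi (t (S i) * w))%C.
          rewrite Cpow_mult_l, J1, G3. field. auto.
        * apply (sdiff_mult (rt i) (fun w => g (psi (t (S i) * w) / psi (t i * w)))%C); auto.
          apply (sdiff_comp (fun w => psi (t (S i) * w) / psi (t i * w))%C g); auto.
          apply (sdiff_mult (fun w => psi (t (S i) * w)%C) (fun w => / psi (t i * w))%C); auto.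
          apply (sdiff_comp (fun w => psi (t i * w)%C) Cinv); [apply St; auto; lia|].
          apply sderiv_inv. auto. }
  destruct (K N (le_n _)) as [K1 K2]. exists (rt N). split; auto.
  intros w Hw. destruct (K2 w Hw) as [K3 K4]. split; auto.
  replace (t N * w)%C with w in K3; auto.
  unfold t. replace (INR N / INR N) with 1 by (field; lra). ring.
Qed.

(** Obtained by differentiating [(w - c)^q = z^p] at [(z, w)]. *)
Definition branch_deriv (p q : nat) (c z w : C) : C :=
  (INR p * z ^ (p - 1)) / (INR q * (w - c) ^ (q - 1)).

Fixpoint chain_deriv (p q : nat) (c : C) (z : nat -> C) (m k : nat) : C :=
  match k with
  | O => RtoC 1
  | S k' => (branch_deriv p q c (z (m + k')%nat) (z (S (m + k'))) * chain_deriv p q c z m k')%C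
  end.

Lemma corr_neq (p q : nat) (c z w : C) :
  (0 < q)%nat -> corr p q c z w -> z <> 0%C -> (w - c <> 0)%C.
Proof.
  intros Hq H Hz E. unfold corr in H. rewrite E, Cpow_0_l in H by auto.
  symmetry in H. now apply Cpow_eq_0 in H.
Qed.

Lemma branch_deriv_neq_0 (p q : nat) (c z w : C) :
  (0 < p)%nat -> (0 < q)%nat -> corr p q c z w -> z <> 0%C -> branch_deriv p q c z w <> 0%C.
Proof.
  intros Hp Hq H Hz. assert (Hw := corr_neq _ _ _ _ _ Hq H Hz).
  unfold branch_deriv. intros E.
  assert (A : (INR q * (w - c) ^ (q - 1) <> 0)%C)
    by (apply Cmult_neq_0; [now apply RtoC_INR_neq_0|now apply Cpow_nz]).
  assert (B : (INR p * z ^ (p - 1) <> 0)%C)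
    by (apply Cmult_neq_0; [now apply RtoC_INR_neq_0|now apply Cpow_nz]).
  apply B. replace (INR p * z ^ (p - 1))%C with
    ((INR p * z ^ (p - 1)) / (INR q * (w - c) ^ (q - 1)) * (INR q * (w - c) ^ (q - 1)))%C.
  - rewrite E. ring.
  - field. split; [now apply Cpow_nz|now apply RtoC_INR_neq_0].
Qed.

Lemma finite_min (P : nat -> R -> Prop) (M : nat) :
  (forall i d d', d' <= d -> P i d -> P i d') ->
  (forall i, (i < M)%nat -> exists d, 0 < d /\ P i d) ->
  exists d, 0 < d /\ forall i, (i < M)%nat -> P i d.
Proof.
  intros Hm. induction M as [|M IH]; intros H.
  - exists 1. split; [lra|]. lia.
  - destruct IH as [d [Hd H1]]; [auto|]. destruct (H M) as [d' [Hd' H2]]; [lia|].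
    exists (Rmin d d'). split; [apply Rmin_pos; auto|]. intros i Hi.
    destruct (Nat.eq_dec i M) as [->|].
    + apply (Hm M d'); auto. apply Rmin_r.
    + apply (Hm i d); [apply Rmin_l|apply H1; lia].
Qed.

(** [W] is the product of the [w - z i] over the [i < M] with [z i <> x]. The bound by
    [Cmod (w - z i)] expresses its vanishing at these points in a quantitative form. *)
Lemma vanishing_poly (z : nat -> C) (x : C) (r : R) (M : nat) :
  0 <= r -> (forall i, Cmod (z i) <= r) ->
  exists (W : C -> C) B, 0 <= B /\ (forall w, sdiff W w) /\ W x <> 0%C /\
    (forall w, Cmod w <= r -> Cmod (W w) <= B) /\
    (forall i w, (i < M)%nat -> z i <> x -> Cmod w <= r -> Cmod (W w) <= B * Cmod (w - z i)).
Proof.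
  intros Hr Hz. induction M as [|M [W [B [HB [HS [Hx [Hb HW]]]]]]].
  - exists (fun _ => RtoC 1), 1. split; [lra|]. split; [intros w; exists 0%C; apply sderiv_const|].
    split. { intros E. apply RtoC_inj in E. lra. }
    split; [intros; rewrite Cmod_1; lra|]. lia.
  - destruct (Ceq_dec (z M) x) as [E|E].
    + exists W, B. repeat split; auto. intros i w Hi Hne Hw.
      destruct (Nat.eq_dec i M) as [->|]; [contradiction|]. apply HW; auto. lia.
    + exists (fun w => W w * (w - z M))%C, (B * (2 * r + 1)).
      split; [nra|]. split.
      { intros w. apply sdiff_mult; auto. exists (1 + 0)%C.
        apply (sderiv_plus (fun w => w) (fun _ => - z M)%C); [apply sderiv_id|apply sderiv_const]. }
      split.
      { apply Cmult_neq_0; auto. intros E'. apply E. symmetry.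
        replace x with (x - z M + z M)%C by ring. rewrite E'. ring. }
      assert (Hd : forall w, Cmod w <= r -> 0 <= Cmod (w - z M) <= 2 * r).
      { intros w Hw. split; [apply Cmod_ge_0|].
        eapply Rle_trans; [apply Cmod_sub_le|]. specialize (Hz M). lra. }
      split.
      * intros w Hw. rewrite Cmod_mult. specialize (Hd w Hw). specialize (Hb w Hw).
        apply Rmult_le_compat; try lra; apply Cmod_ge_0.
      * intros i w Hi Hne Hw. rewrite Cmod_mult. specialize (Hd w Hw).
        assert (H0 := Cmod_ge_0 (W w)). assert (Hi0 := Cmod_ge_0 (w - z i)).
        destruct (Nat.eq_dec i M) as [->|].
        -- apply Rmult_le_compat_r; [lra|]. specialize (Hb w Hw). nra.
        -- specialize (HW i w ltac:(lia) Hne Hw).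
           apply Rle_trans with (B * Cmod (w - z i) * (2 * r)).
           ++ apply Rmult_le_compat; lra.
           ++ assert (0 <= B * Cmod (w - z i)) by (apply Rmult_le_pos; auto). lra.
Qed.

(** The last clause excludes the whole orbit and not just the critical value [a = z 0]: only in this
    form does it survive a pull-back. *)
Definition disc_map (U : C -> Prop) (z : nat -> C) (j : nat) (phi : C -> C) : Prop :=
  phi 0%C = z j /\
  forall w, Cmod w <= 1 -> sdiff phi w /\ U (phi w) /\ forall i, phi w = z i -> w = 0%C.

(** [U] stands for a neighbourhood of the filled Julia set in which [z] is the only
    forward orbit of [a]. *)
Record trapping (p q : nat) (a : C) (z : nat -> C) (U : C -> Prop) (r e : R) (M : nat)
    : Prop := {
  trap_q : (0 < q)%nat;
  trap_p : (0 < p)%nat;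
  trap_e : 0 < e;
  trap_start : z O = a;
  trap_orbit : forall i, corr p q a (z i) (z (S i));
  trap_neq : forall i, z i <> 0%C;
  trap_finite : forall i, exists i', (i' < M)%nat /\ z i = z i';
  trap_bounded : forall w, U w -> Cmod w <= r;
  trap_in : forall i, U (z i);
  trap_margin : forall u u' w, corr p q a u w -> U w -> Cmod (u' - u) <= e -> U u';
  trap_unique : forall i w, corr p q a (z i) w -> U w -> w = z (S i)
}.

(** If [phi w = a = z 0], then [w = 0]; but [phi 0 = z (S j)] differs from [a] because [z j] is not
    [0]. So [(phi w - a) ^ q] has no zero and has a [p]-th root with value [z j] at [0]. Where the
    root equals [z i], its image [phi w] in [U] must be [z (S i)], and again [w = 0]. *)
Lemma disc_map_pull_back (p q : nat) (a : C) (z : nat -> C) (U : C -> Prop) (r e : R) (M : nat)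
    (j : nat) (phi : C -> C) (b : C) :
  trapping p q a z U r e M -> disc_map U z (S j) phi -> sderiv phi 0 b ->
  exists phi1 : C -> C, phi1 0%C = z j /\
    (forall w, Cmod w <= 1 -> sdiff phi1 w /\ corr p q a (phi1 w) (phi w) /\
       forall i, phi1 w = z i -> w = 0%C) /\
    sderiv phi1 0 (b / branch_deriv p q a (z j) (z (S j))).
Proof.
  intros HT [P0 P1] Hb.
  assert (Hp := trap_p _ _ _ _ _ _ _ _ HT). assert (Hq := trap_q _ _ _ _ _ _ _ _ HT).
  assert (Hj := trap_orbit _ _ _ _ _ _ _ _ HT j). assert (Hzj := trap_neq _ _ _ _ _ _ _ _ HT j).
  assert (Hzw := corr_neq _ _ _ _ _ Hq Hj Hzj).
  assert (H00 : Cmod 0 <= 1) by (rewrite Cmod_0; lra).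
  destruct (root_on_disc p (fun w => (phi w - a) ^ q)%C (z j)) as [phi1 [F0 F1]]; auto.
  - intros w Hw. apply (sdiff_comp (fun w => phi w - a)%C (fun u => u ^ q)%C).
    + apply (sdiff_plus phi (fun _ => - a)%C); [now apply P1|eexists; apply sderiv_const].
    + eexists. apply sderiv_pow.
  - intros w Hw E. apply Cpow_eq_0 in E.
    assert (Ea : phi w = z O).
    { rewrite (trap_start _ _ _ _ _ _ _ _ HT).
      replace (phi w) with (phi w - a + a)%C by ring. rewrite E. ring. }
    assert (E0 := proj2 (proj2 (P1 w Hw)) O Ea). subst w. rewrite P0 in E. contradiction.
  - rewrite P0. symmetry. exact Hj.
  - exists phi1. split; auto. split.
    + intros w Hw. destruct (F1 w Hw) as [F2 F3]. split; auto.
      split; [symmetry; exact F2|]. intros i Ei.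
      destruct (P1 w Hw) as [_ [P2 P3]]. apply (P3 (S i)).
      apply (trap_unique _ _ _ _ _ _ _ _ HT); auto. rewrite <- Ei. symmetry. exact F2.
    + destruct (F1 0%C H00) as [_ [al F3]].
      assert (D : sderiv (fun w => (phi w - a) ^ q)%C 0 (INR q * (z (S j) - a) ^ (q - 1) * b)).
      { assert (D1 := sderiv_plus _ _ _ _ _ Hb (sderiv_const (- a)%C 0)).
        assert (D2 := sderiv_comp _ _ _ _ _ D1 (sderiv_pow q (phi 0 + - a)%C)).
        rewrite P0 in D2. unfold Cminus. replace (b + 0)%C with b in D2 by ring. exact D2. }
      replace (b / branch_deriv p q a (z j) (z (S j)))%C with
        ((INR q * (z (S j) - a) ^ (q - 1) * b) / (INR p * z j ^ (p - 1)))%C.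
      * apply (sderiv_implicit (fun w => (phi w - a) ^ q)%C (fun u => u ^ p)%C phi1 _ _ _ 1); auto.
        -- apply (sderiv_cont _ _ _ F3).
        -- lra.
        -- intros y Hy. apply F1. replace (y - 0)%C with y in Hy by ring. lra.
        -- rewrite F0. apply sderiv_pow.
        -- apply Cmult_neq_0; [now apply RtoC_INR_neq_0|now apply Cpow_nz].
      * unfold branch_deriv. field. repeat split;
          first [now apply Cpow_nz | now apply RtoC_INR_neq_0].
Qed.

(** After pulling back, composing with [u + eps * Q u], where [Q] vanishes on the
    orbit, uses up the margin and increases the derivative. *)
Lemma disc_map_step (p q : nat) (a : C) (z : nat -> C) (U : C -> Prop) (r e : R) (M : nat)
    (j : nat) :
  trapping p q a z U r e M ->
  exists kap, 1 < kap /\ forall phi b, disc_map U z (S j) phi -> sderiv phi 0 b ->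
    exists phi' b', disc_map U z j phi' /\ sderiv phi' 0 b' /\
      kap * Cmod b <= Cmod b' * Cmod (branch_deriv p q a (z j) (z (S j))).
Proof.
  intros HT.
  assert (Hz : forall i, Cmod (z i) <= r).
  { intros i. apply (trap_bounded _ _ _ _ _ _ _ _ HT), (trap_in _ _ _ _ _ _ _ _ HT). }
  assert (Hr : 0 <= r) by (eapply Rle_trans; [apply Cmod_ge_0|apply (Hz O)]).
  assert (He := trap_e _ _ _ _ _ _ _ _ HT).
  destruct (vanishing_poly z (z j) r M Hr Hz) as [W [B [HB [HS [Hx [Hb HW]]]]]].
  assert (Hm : 0 < Cmod (W (z j))) by now apply Cmod_gt_0.
  (* Chosen so that [v * ((2 * r + 1) * B) <= Rmin e 1 / 2]: this bounds the displacement of [E] by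
     the margin and its Lipschitz-type bound at orbit points by [1 / 2]. *)
  set (v := Rmin e 1 / (2 * (2 * r + 1) * (B + 1))).
  assert (Hmin : 0 < Rmin e 1) by (apply Rmin_pos; lra).
  assert (HD : 0 < 2 * (2 * r + 1) * (B + 1)) by (apply Rmult_lt_0_compat; lra).
  assert (Hv : 0 < v) by (apply Rdiv_lt_0_compat; auto).
  assert (Ev : v * ((2 * r + 1) * (B + 1)) = Rmin e 1 / 2) by (unfold v; field; lra).
  assert (Hme : Rmin e 1 <= e) by apply Rmin_l. assert (Hm1 : Rmin e 1 <= 1) by apply Rmin_r.
  assert (HvB : v * ((2 * r + 1) * B) <= v * ((2 * r + 1) * (B + 1)))
    by (apply Rmult_le_compat_l; [lra|]; apply Rmult_le_compat_l; lra).
  set (t := v * Cmod (W (z j))). assert (Ht : 0 < t) by (apply Rmult_lt_0_compat; auto).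
  (* The argument of [eps] makes [eps * W (z j)] the positive number [t], so the derivative of [E]
     at [z j] is exactly [1 + t]. *)
  set (eps := (RtoC t / W (z j))%C).
  assert (Heps : Cmod eps = v).
  { unfold eps. rewrite Cmod_div, Cmod_R, Rabs_pos_eq by (auto; lra). unfold t. field. lra. }
  set (E := fun u => (u + eps * ((u - z j) * W u))%C).
  assert (HE : forall u, Cmod u <= r -> Cmod (E u - u) <= e).
  { intros u Hu. unfold E. replace (u + eps * ((u - z j) * W u) - u)%C with (eps * ((u - z j) * W u))%C by ring.
    rewrite !Cmod_mult, Heps.
    assert (Cmod (u - z j) * Cmod (W u) <= (2 * r + 1) * B).
    { apply Rmult_le_compat; try apply Cmod_ge_0; auto.
      eapply Rle_trans; [apply Cmod_sub_le|]. specialize (Hz j). lra. }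
    assert (v * (Cmod (u - z j) * Cmod (W u)) <= v * ((2 * r + 1) * B)) by (apply Rmult_le_compat_l; lra).
    lra. }
  (* [E] must not create new orbit values. If [E u = z i], the displacement is [u - z i] up to sign,
     and it is at most half of [Cmod (u - z i)], through the factor [u - z j] when [z i = z j] and
     through [W] otherwise. *)
  assert (HEz : forall u i, Cmod u <= r -> E u = z i -> u = z i).
  { intros u i0 Hu0 E0. destruct (trap_finite _ _ _ _ _ _ _ _ HT i0) as [i [Hi Ei]].
    rewrite Ei in *. apply Cmod_sub_eq_0.
    assert (E1 : (u - z i)%C = (- (eps * ((u - z j) * W u)))%C) by (rewrite <- E0; unfold E; ring).
    assert (E2 : Cmod (u - z i) = v * (Cmod (u - z j) * Cmod (W u))).
    { rewrite E1, Cmod_opp, !Cmod_mult, Heps. reflexivity. }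
    assert (Hd : Cmod (u - z j) <= 2 * r).
    { eapply Rle_trans; [apply Cmod_sub_le|]. specialize (Hz j). lra. }
    assert (H0 := Cmod_ge_0 (u - z i)). assert (H1 := Cmod_ge_0 (u - z j)).
    assert (H2 := Cmod_ge_0 (W u)).
    assert (B1 : Cmod (u - z j) * Cmod (W u) <= ((2 * r + 1) * B) * Cmod (u - z i)).
    { destruct (Ceq_dec (z i) (z j)) as [Eij|Eij].
      - rewrite Eij in *. rewrite Rmult_comm. apply Rmult_le_compat_r; auto.
        specialize (Hb u Hu0). assert (0 <= r * B) by (apply Rmult_le_pos; auto). lra.
      - specialize (HW i u Hi Eij Hu0).
        apply Rle_trans with ((2 * r) * (B * Cmod (u - z i))).
        + apply Rmult_le_compat; auto.
        + assert (0 <= B * Cmod (u - z i)) by (apply Rmult_le_pos; auto). lra. }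
    assert (v * (Cmod (u - z j) * Cmod (W u)) <= v * (((2 * r + 1) * B) * Cmod (u - z i)))
      by (apply Rmult_le_compat_l; lra).
    assert (v * ((2 * r + 1) * B) * Cmod (u - z i) <= / 2 * Cmod (u - z i))
      by (apply Rmult_le_compat_r; lra).
    lra. }
  assert (DE : forall u, sdiff E u).
  { intros u. apply (sdiff_plus (fun u => u) (fun u => eps * ((u - z j) * W u))%C).
    - eexists. apply sderiv_id.
    - apply (sdiff_mult (fun _ => eps) (fun u => (u - z j) * W u)%C); [eexists; apply sderiv_const|].
      apply (sdiff_mult (fun u => u - z j)%C W); auto.
      apply (sdiff_plus (fun u => u) (fun _ => - z j)%C); eexists; [apply sderiv_id|apply sderiv_const]. }
  assert (DEj : sderiv E (z j) (RtoC (1 + t))).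
  { destruct (HS (z j)) as [w' Hw'].
    assert (D1 := sderiv_plus _ _ _ _ _ (sderiv_id (z j)) (sderiv_const (- z j)%C (z j))).
    assert (D2 := sderiv_mult _ _ _ _ _ D1 Hw').
    assert (D3 := sderiv_mult _ _ _ _ _ (sderiv_const eps (z j)) D2).
    assert (D4 := sderiv_plus _ _ _ _ _ (sderiv_id (z j)) D3). simpl in D4.
    replace (RtoC (1 + t)) with
     (1 + (0 * ((z j + - z j) * W (z j)) + eps * ((1 + 0) * W (z j) + (z j + - z j) * w')))%C; [exact D4|].
    rewrite RtoC_plus. unfold eps. field. auto. }
  exists (1 + t). split; [lra|]. intros phi b Hphi Hderiv.
  destruct (disc_map_pull_back _ _ _ _ _ _ _ _ j phi b HT Hphi Hderiv) as [phi1 [F0 [F1 F2]]].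
  destruct Hphi as [P0 P1].
  assert (HU1 : forall w, Cmod w <= 1 -> Cmod (phi1 w) <= r).
  { intros w Hw. apply (trap_bounded _ _ _ _ _ _ _ _ HT).
    apply (trap_margin _ _ _ _ _ _ _ _ HT (phi1 w) (phi1 w) (phi w)).
    - now apply F1.
    - now apply P1.
    - rewrite Cmod_sub_diag. lra. }
  set (bd := branch_deriv p q a (z j) (z (S j))) in *.
  assert (Hbd : bd <> 0%C).
  { apply branch_deriv_neq_0; apply HT. }
  exists (fun w => E (phi1 w)), (RtoC (1 + t) * (b / bd))%C. split; [split|split].
  - rewrite F0. unfold E. ring.
  - intros w Hw. destruct (F1 w Hw) as [F3 [F4 F5]]. split; [|split].
    + now apply sdiff_comp.
    + apply (trap_margin _ _ _ _ _ _ _ _ HT (phi1 w) _ (phi w)); auto. now apply P1.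
    + intros i Ei. apply (F5 i). apply HEz; auto.
  - apply sderiv_comp; auto. rewrite F0. auto.
  - rewrite Cmod_mult, Cmod_div, Cmod_R, Rabs_pos_eq by (auto; lra).
    assert (0 < Cmod bd) by now apply Cmod_gt_0.
    apply Req_le. field. lra.
Qed.

(** [kap] is fixed before [phi], so that successive turns around the cycle multiply it. *)
Lemma disc_map_chain (p q : nat) (a : C) (z : nat -> C) (U : C -> Prop) (r e : R) (M : nat)
    (l k : nat) :
  trapping p q a z U r e M ->
  exists kap, (1 < kap \/ (kap = 1 /\ k = O)) /\
    forall phi b, disc_map U z (l + k) phi -> sderiv phi 0 b ->
    exists phi' b', disc_map U z l phi' /\ sderiv phi' 0 b' /\
      kap * Cmod b <= Cmod b' * Cmod (chain_deriv p q a z l k).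
Proof.
  intros HT. induction k as [|k [kap [Hk IH]]].
  - exists 1. split; [auto|]. intros phi b H1 H2. exists phi, b.
    rewrite Nat.add_0_r in H1. repeat split; try apply H1; auto. simpl.
    rewrite Cmod_1. lra.
  - destruct (disc_map_step _ _ _ _ _ _ _ _ (l + k) HT) as [kap' [Hk' Hstep]].
    exists (kap * kap'). split; [left; nra|]. intros phi b H1 H2.
    replace (l + S k)%nat with (S (l + k)) in H1 by lia.
    destruct (Hstep phi b H1 H2) as [phi1 [b1 [S1 [S2 S3]]]].
    destruct (IH phi1 b1 S1 S2) as [phi2 [b2 [T1 [T2 T3]]]].
    exists phi2, b2. split; auto. split; auto.
    simpl. rewrite Cmod_mult. set (bd := Cmod (branch_deriv _ _ _ _ _)) in *.
    assert (0 <= bd) by apply Cmod_ge_0.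
    assert (kap * (kap' * Cmod b) <= kap * (Cmod b1 * bd)) by (apply Rmult_le_compat_l; lra).
    assert (kap * Cmod b1 * bd <= Cmod b2 * Cmod (chain_deriv p q a z l k) * bd)
      by (apply Rmult_le_compat_r; auto).
    lra.
Qed.

Lemma cycle_repelling (p q : nat) (a : C) (z : nat -> C) (U : C -> Prop) (r e : R) (M : nat)
    (l n : nat) :
  trapping p q a z U r e M -> (0 < n)%nat -> z (l + n)%nat = z l ->
  1 < Cmod (chain_deriv p q a z l n).
Proof.
  intros HT Hn Hper. destruct (Rlt_le_dec 1 (Cmod (chain_deriv p q a z l n))) as [|Hle]; auto.
  exfalso. assert (He := trap_e _ _ _ _ _ _ _ _ HT).
  destruct (disc_map_chain _ _ _ _ _ _ _ _ l n HT) as [kap [[Hk|[_ Hk]] Hchain]]; [|lia].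
  destruct (finite_min (fun i s => z i <> z l -> s < Cmod (z i - z l)) M) as [s [Hs Hsep]].
  { intros i d d' Hd H Hi. specialize (H Hi). lra. }
  { intros i _. destruct (Ceq_dec (z i) (z l)) as [E|E].
    - exists 1. split; [lra|]. contradiction.
    - apply Cmod_sub_pos in E. exists (Cmod (z i - z l) / 2). split; lra. }
  (* The starting map is the affine disc of this radius at [z l]: [s] keeps it off the other orbit
     points, [e] keeps it in [U]. *)
  set (s' := Rmin s e). assert (Hs' : 0 < s') by (apply Rmin_pos; auto).
  assert (Hss : s' <= s) by apply Rmin_l. assert (Hse : s' <= e) by apply Rmin_r.
  assert (Grow : forall m, exists phi b, disc_map U z l phi /\ sderiv phi 0 b /\ kap ^ m * s' <= Cmod b).
  { induction m as [|m [phi [b [G1 [G2 G3]]]]].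
    - exists (fun w => RtoC s' * w + z l)%C, (RtoC s').
      assert (Hd : forall w, Cmod w <= 1 -> Cmod (s' * w + z l - z l) <= s').
      { intros w Hw. replace (s' * w + z l - z l)%C with (RtoC s' * w)%C by ring.
        rewrite Cmod_mult, Cmod_R, Rabs_pos_eq by lra. generalize (Cmod_ge_0 w). nra. }
      split; [split|split].
      + ring.
      + intros w Hw. specialize (Hd w Hw). split; [|split].
        * eexists. apply sderiv_affine.
        * apply (trap_margin _ _ _ _ _ _ _ _ HT (z l) _ (z (S l))); [apply HT|apply HT|lra].
        * intros i0 E0. destruct (trap_finite _ _ _ _ _ _ _ _ HT i0) as [i [Hi Ei]].
          rewrite Ei in E0. rewrite E0 in Hd.
          destruct (Ceq_dec (z i) (z l)) as [E|E].
          -- rewrite E in E0.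
             assert (E1 : (RtoC s' * w = 0)%C).
             { replace (RtoC s' * w)%C with (RtoC s' * w + z l - z l)%C by ring. rewrite E0. ring. }
             apply Cmult_integral_l in E1; auto. intros E2. apply RtoC_inj in E2. lra.
          -- specialize (Hsep i Hi E). lra.
      + apply sderiv_affine.
      + rewrite Cmod_R, Rabs_pos_eq by lra. simpl. lra.
    -
      (* As [z (l + n) = z l], a map at [l] is also one at [l + n] and can be pulled back around the
         whole cycle. *)
      assert (G1' : disc_map U z (l + n) phi).
      { destruct G1 as [G0 G1]. split; auto. now rewrite Hper. }
      destruct (Hchain phi b G1' G2) as [phi' [b' [C1 [C2 C3]]]].
      exists phi', b'. split; auto. split; auto.
      assert (Cmod b' * Cmod (chain_deriv p q a z l n) <= Cmod b' * 1)
        by (apply Rmult_le_compat_l; [apply Cmod_ge_0|auto]).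
      assert (kap * (kap ^ m * s') <= kap * Cmod b) by (apply Rmult_le_compat_l; lra).
      simpl. lra. }
  assert (s' <= 0); [|lra].
  apply le_0_of_geometric with (rho := / kap) (A := 4 * r).
  { assert (0 < / kap) by (apply Rinv_0_lt_compat; lra).
    split; [lra|]. rewrite <- Rinv_1. apply Rinv_lt_contravar; lra. }
  intros m. destruct (Grow m) as [phi [b [[G0 G1] [G2 G3]]]].
  assert (Cmod b <= 4 * r).
  { apply (cauchy_estimate phi); auto.
    - intros w Hw. apply (G1 w Hw).
    - intros w Hw. apply (trap_bounded _ _ _ _ _ _ _ _ HT). now apply G1. }
  rewrite pow_inv. assert (0 < kap ^ m) by (apply pow_lt; lra).
  apply (Rle_div_r s' (4 * r) (kap ^ m)); lra.
Qed.

(** * The perturbed orbit *)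

Lemma bounded_forward_orbit_cons (p q : nat) (c z0 w0 : C) (z : nat -> C) :
  corr p q c z0 w0 -> bounded_forward_orbit p q c w0 z ->
  bounded_forward_orbit p q c z0 (fun j => match j with O => z0 | S j => z j end).
Proof.
  intros H [H1 [H2 H3]]. split; [reflexivity|]. split.
  - intros [|j]; auto. now rewrite H1.
  - apply bounded_seq_iff in H3. destruct H3 as [M HM]. apply bounded_seq_iff.
    exists (Rmax (Cmod z0) M). intros [|j]; [apply Rmax_l|].
    eapply Rle_trans; [apply HM|apply Rmax_r].
Qed.

Lemma bounded_forward_orbit_shift (p q : nat) (c z0 : C) (z : nat -> C) (k : nat) :
  bounded_forward_orbit p q c z0 z ->
  bounded_forward_orbit p q c (z k) (fun j => z (k + j)%nat).
Proof.
  intros [H1 [H2 H3]]. split; [f_equal; lia|]. split.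
  - intros j. replace (k + S j)%nat with (S (k + j)) by lia. auto.
  - apply bounded_seq_iff in H3. destruct H3 as [M HM]. apply bounded_seq_iff. eauto.
Qed.

(** A different bounded continuation of [y i], preceded by [y 0, ..., y i], would be a second
    bounded orbit of [z0]. *)
Lemma unique_orbit_step (p q : nat) (c z0 : C) (y : nat -> C) :
  bounded_forward_orbit p q c z0 y ->
  (forall z', bounded_forward_orbit p q c z0 z' -> forall j, z' j = y j) ->
  forall i w, corr p q c (y i) w -> filled_julia p q c w -> w = y (S i).
Proof.
  intros Hy Hu i. revert z0 y Hy Hu.
  induction i as [|i IH]; intros z0 y Hy Hu w Hc [u Hw].
  - rewrite (proj1 Hy) in Hc. assert (E := bounded_forward_orbit_cons _ _ _ _ _ _ Hc Hw).
    rewrite <- (Hu _ E 1%nat). symmetry. apply Hw.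
  - apply (IH (y 1%nat) (fun j => y (S j))); auto; [|intros z' Hz' j|exists u; auto].
    + apply (bounded_forward_orbit_shift _ _ _ _ _ 1 Hy).
    + assert (H01 : corr p q c z0 (y 1%nat)) by (rewrite <- (proj1 Hy); apply Hy).
      apply (Hu _ (bounded_forward_orbit_cons _ _ _ _ _ _ H01 Hz') (S j)).
Qed.

(** [0] followed by [z] is the unique bounded orbit of [0]. If [z i = 0], the tail starting there is
    a bounded orbit of [0] too, so it equals the whole orbit, which would be periodic. *)
Lemma misiurewicz_orbit (p q : nat) (a : C) (z : nat -> C) :
  (0 < p)%nat -> (0 < q)%nat -> misiurewicz p q a -> bounded_forward_orbit p q a a z ->
  (forall i, z i <> 0%C) /\
  (forall i w, corr p q a (z i) w -> filled_julia p q a w -> w = z (S i)).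
Proof.
  intros Hp Hq [y [Hy [Hu [_ Hnp]]]] Hz.
  assert (H0 : corr p q a 0 a).
  { unfold corr. replace (a - a)%C with (RtoC 0) by ring. now rewrite !Cpow_0_l. }
  assert (Ez : forall j, z j = y (S j)).
  { intros j. apply (Hu _ (bounded_forward_orbit_cons _ _ _ _ _ _ H0 Hz) (S j)). }
  split.
  - intros i E. apply Hnp. exists (S i). split; [lia|]. intros j. rewrite Nat.add_comm.
    apply (Hu (fun j => y (S i + j)%nat)).
    replace (RtoC 0) with (y (S i)) by (rewrite <- Ez; auto).
    eapply bounded_forward_orbit_shift, Hy.
  - intros i w. rewrite !Ez. apply (unique_orbit_step _ _ _ _ _ Hy Hu).
Qed.

Lemma image_close (p q : nat) (r : R) (a u v : C) (eta : R) :
  (forall w, corr p q a u w -> filled_julia p q a w -> w = v) -> 0 < eta ->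
  exists d, 0 < d /\ forall c z w, Cmod (c - a) <= d -> Cmod (z - u) <= d -> corr p q c z w ->
    (forall N, pseudo_orbit p q r d c N w) -> Cmod (w - v) < eta.
Proof.
  intros Hu He.
  destruct (image_near p q r a u (fun w => Cmod (w - v) < eta)) as [d [Hd H]].
  - intros w Hw Hrec. apply pseudo_recurrent_filled_julia in Hrec.
    rewrite (Hu w Hw Hrec). eauto.
  - destruct (nfloor_ex (/ d)) as [N HN]; [apply Rlt_le, Rinv_0_lt_compat; auto|].
    exists d. split; auto. intros c z w Hc Hz Hw HP.
    apply (H c z w (S N)); auto; [lra|]. rewrite S_INR. lra.
Qed.

(** The condition is put on [w - c], so the injectivity radius of the [q]-th power at [u0] serves
    all [c] and [z] at once. *)
Lemma corr_locally_unique (p q : nat) (u0 : C) :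
  (0 < q)%nat -> u0 <> 0%C -> exists eta, 0 < eta /\ forall c z w w',
    corr p q c z w -> corr p q c z w' -> Cmod (w - c - u0) < eta -> Cmod (w' - c - u0) < eta ->
    w = w'.
Proof.
  intros Hq Hu.
  destruct (sderiv_lower _ _ _ (sderiv_pow q u0)) as [eta [He H]].
  { apply Cmult_neq_0; [now apply RtoC_INR_neq_0|now apply Cpow_nz]. }
  exists eta. split; auto. intros c z w w' Hw Hw' H1 H2.
  specialize (H _ _ H1 H2). unfold corr in *. rewrite Hw, Hw', Cmod_sub_diag in H.
  assert (Hm : 0 < Cmod (INR q * u0 ^ (q - 1))).
  { apply Cmod_gt_0, Cmult_neq_0; [now apply RtoC_INR_neq_0|now apply Cpow_nz]. }
  assert (E : (w - c)%C = (w' - c)%C).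
  { apply Cmod_sub_eq_0. generalize (Cmod_ge_0 (w - c - (w' - c))). nra. }
  replace w with (w - c + c)%C by ring. rewrite E. ring.
Qed.

(** [U] consists of the points with pseudo-orbits of every length in the disc of radius [2 * r0].
    Preimages of that disc lie in the one of radius [r0], by escape, so a margin of at most [1]
    stays inside. Uniqueness holds because images in [U] are close to [z (S i)], hence equal to it
    by local injectivity; finitely many orbit points allow one [e]. *)
Lemma orbit_trapping (p q : nat) (a : C) (z : nat -> C) (M : nat) :
  (0 < q)%nat -> (q < p)%nat -> bounded_forward_orbit p q a a z ->
  (forall i, z i <> 0%C) ->
  (forall i w, corr p q a (z i) w -> filled_julia p q a w -> w = z (S i)) ->
  (forall i, exists i', (i' < M)%nat /\ z i = z i' /\ z (S i) = z (S i')) ->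
  exists U r e, trapping p q a z U r e M.
Proof.
  intros Hq Hpq Hz Hne Hu Hfin.
  set (r0 := 3 ^ q + Cmod a + 1).
  assert (H3 : 1 <= 3 ^ q) by (apply pow_R1_Rle; lra).
  assert (Ha : 0 <= Cmod a) by apply Cmod_ge_0.
  assert (Hr0 : 2 <= r0) by (unfold r0; lra).
  assert (HK : forall i, filled_julia p q a (z i)).
  { intros i. exists (fun j => z (i + j)%nat). apply (bounded_forward_orbit_shift _ _ _ _ _ i Hz). }
  assert (Hcorr : forall i, corr p q a (z i) (z (S i))) by apply Hz.
  destruct (finite_min (fun i d => forall w, corr p q a (z i) w ->
     (forall N, pseudo_orbit p q (2 * r0) d a N w) -> w = z (S i)) M) as [e [He Hsep]].
  { intros i d d' Hd H w Hw HP. apply H; auto. intros N.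
    eapply pseudo_orbit_le; [apply Hd|apply le_n|apply HP]. }
  { intros i _.
    assert (Hn := corr_neq _ _ _ _ _ Hq (Hcorr i) (Hne i)).
    destruct (corr_locally_unique p q _ Hq Hn) as [eta [Heta Hloc]].
    destruct (image_close p q (2 * r0) a (z i) (z (S i)) eta (Hu i) Heta) as [d [Hd Himg]].
    exists d. split; auto. intros w Hw HP.
    apply (Hloc a (z i)); auto.
    - replace (w - a - (z (S i) - a))%C with (w - z (S i))%C by ring.
      apply (Himg a (z i)); auto; rewrite Cmod_sub_diag; lra.
    - rewrite Cmod_sub_diag. auto. }
  exists (fun w => forall N, pseudo_orbit p q (2 * r0) (Rmin e 1) a N w), (2 * r0), (Rmin e 1).
  assert (He1 : 0 < Rmin e 1) by (apply Rmin_pos; lra).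
  constructor; auto; try lia.
  - apply Hz.
  - intros i. destruct (Hfin i) as [i' [Hi [E _]]]. eauto.
  - intros w Hw. apply (pseudo_orbit_norm _ _ _ _ _ _ _ (Hw O)).
  - intros i N. apply filled_julia_pseudo_orbit; auto; [|lra]. unfold r0. lra.
  - intros u u' w Hc Hw Hd.
    assert (Bw := pseudo_orbit_norm _ _ _ _ _ _ _ (Hw O)).
    assert (Bu : Cmod u <= r0).
    { destruct (Rle_lt_dec (Cmod u) r0) as [|h]; auto.
      assert (E := corr_escape p q a u w Hq Hpq ltac:(unfold r0 in h; lra) Hc). lra. }
    assert (Bu' : Cmod u' <= 2 * r0).
    { assert (E := Cmod_le_sub u' u). generalize (Rmin_r e 1). lra. }
    intros [|N]; (split; [auto|]); auto.
    exists u, w. rewrite Cmod_sub_sym. auto.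
  - intros i w Hc HP. destruct (Hfin i) as [i' [Hi [E1 E2]]]. rewrite E1 in Hc. rewrite E2.
    apply (Hsep i'); auto. intros N.
    eapply pseudo_orbit_le; [apply Rmin_l|apply le_n|apply HP].
Qed.

(** * Continuity in the parameter *)

Lemma cont_at_mult (f g : C -> C) (x : C) :
  cont_at f x -> cont_at g x -> cont_at (fun w => f w * g w)%C x.
Proof.
  intros Hf Hg e He.
  set (m := Cmod (f x) + Cmod (g x) + 1).
  assert (Hm : 1 <= m) by (unfold m; generalize (Cmod_ge_0 (f x)) (Cmod_ge_0 (g x)); lra).
  set (e' := Rmin 1 (e / (2 * m))).
  assert (He2 : 0 < e / (2 * m)) by (apply Rdiv_lt_0_compat; lra).
  assert (He' : 0 < e') by (apply Rmin_pos; lra).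
  assert (Hl : e' <= 1) by apply Rmin_l. assert (Hr : e' <= e / (2 * m)) by apply Rmin_r.
  apply Rle_div_r in Hr; [|lra].
  destruct (Hf e' He') as [d1 [Hd1 H1]]. destruct (Hg e' He') as [d2 [Hd2 H2]].
  exists (Rmin d1 d2). split; [apply Rmin_pos; auto|]. intros y Hy.
  generalize (Rmin_l d1 d2) (Rmin_r d1 d2). intros.
  specialize (H1 y ltac:(lra)). specialize (H2 y ltac:(lra)).
  eapply Rle_lt_trans.
  - apply (Cmod_le_add _ ((f y - f x) * g y) (f x * (g y - g x))). ring.
  - rewrite !Cmod_mult. assert (E := Cmod_le_sub (g y) (g x)).
    assert (A1 : Cmod (f y - f x) * Cmod (g y) <= e' * (Cmod (g x) + 1))
      by (apply Rmult_le_compat; try apply Cmod_ge_0; lra).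
    assert (A2 : Cmod (f x) * Cmod (g y - g x) <= Cmod (f x) * e')
      by (apply Rmult_le_compat_l; [apply Cmod_ge_0|lra]).
    assert (e' * m = e' * (Cmod (g x) + 1) + Cmod (f x) * e') by (unfold m; ring). lra.
Qed.

Lemma cont_at_plus (f g : C -> C) (x : C) :
  cont_at f x -> cont_at g x -> cont_at (fun w => f w + g w)%C x.
Proof.
  intros Hf Hg e He.
  destruct (Hf (e / 2)) as [d1 [Hd1 H1]]; [lra|]. destruct (Hg (e / 2)) as [d2 [Hd2 H2]]; [lra|].
  exists (Rmin d1 d2). split; [apply Rmin_pos; auto|]. intros y Hy.
  generalize (Rmin_l d1 d2) (Rmin_r d1 d2). intros.
  specialize (H1 y ltac:(lra)). specialize (H2 y ltac:(lra)).
  eapply Rle_lt_trans.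
  - apply (Cmod_le_add _ (f y - f x) (g y - g x)). ring.
  - lra.
Qed.

Lemma cont_at_comp (f g : C -> C) (x : C) :
  cont_at f x -> cont_at g (f x) -> cont_at (fun w => g (f w)) x.
Proof.
  intros Hf Hg e He. destruct (Hg e He) as [d1 [Hd1 H1]].
  destruct (Hf d1 Hd1) as [d2 [Hd2 H2]]. exists d2. auto.
Qed.

Lemma cont_at_const (c x : C) : cont_at (fun _ => c) x.
Proof. apply (sderiv_cont _ _ _ (sderiv_const c x)). Qed.

Lemma cont_at_id (x : C) : cont_at (fun w => w) x.
Proof. apply (sderiv_cont _ _ _ (sderiv_id x)). Qed.

Lemma cont_at_branch_deriv (p q : nat) (a : C) (u v : C -> C) :
  (0 < q)%nat -> cont_at u a -> cont_at v a -> (v a - a <> 0)%C ->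
  cont_at (fun c => branch_deriv p q c (u c) (v c)) a.
Proof.
  intros Hq Hu Hv Hn. unfold branch_deriv, Cdiv.
  apply (cont_at_mult (fun c => INR p * u c ^ (p - 1))%C
           (fun c => / (INR q * (v c - c) ^ (q - 1)))%C).
  - apply (cont_at_mult (fun _ => RtoC (INR p)) (fun c => u c ^ (p - 1))%C); [apply cont_at_const|].
    apply (cont_at_comp u (fun w => w ^ (p - 1))%C); auto.
    apply (sderiv_cont _ _ _ (sderiv_pow _ _)).
  - apply (cont_at_comp (fun c => INR q * (v c - c) ^ (q - 1))%C Cinv).
    + apply (cont_at_mult (fun _ => RtoC (INR q)) (fun c => (v c - c) ^ (q - 1))%C);
        [apply cont_at_const|].
      apply (cont_at_comp (fun c => v c - c)%C (fun w => w ^ (q - 1))%C).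
      * apply (cont_at_plus v (fun c => - c)%C); auto.
        apply (sderiv_cont _ _ (-1)). apply (sderiv_near_ext (fun c => -1 * c + 0)%C _ _ _ 1);
          [lra| |apply sderiv_affine]. intros. ring.
      * apply (sderiv_cont _ _ _ (sderiv_pow _ _)).
    + assert (Hd : (INR q * (v a - a) ^ (q - 1) <> 0)%C)
        by (apply Cmult_neq_0; [now apply RtoC_INR_neq_0|now apply Cpow_nz]).
      destruct (sderiv_inv _ Hd) as [al Hal]. apply (sderiv_cont _ _ _ Hal).
Qed.

Lemma chain_deriv_ext (p q : nat) (c : C) (z z' : nat -> C) (m k : nat) :
  (forall j, z j = z' j) -> chain_deriv p q c z m k = chain_deriv p q c z' m k.
Proof. intros E. induction k as [|k IH]; simpl; auto. now rewrite IH, !E. Qed.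

Lemma compose_from_add (F : nat -> C -> C) (m k k' : nat) (y : C) :
  compose_from F m (k + k') y = compose_from F (m + k) k' (compose_from F m k y).
Proof.
  induction k' as [|k' IH].
  - now rewrite Nat.add_0_r.
  - rewrite Nat.add_succ_r. simpl. rewrite IH. f_equal. lia.
Qed.

(** Continuity of the branch and the equation it solves yield its strong derivative through
    [sderiv_implicit]. *)
Lemma branch_near_sderiv (p q : nat) (a x : C) (f : C -> C) :
  (0 < q)%nat -> univalent_branch_near p q a x f -> x <> 0%C ->
  exists d, 0 < d /\ forall y, Cmod (y - x) < d ->
    corr p q a y (f y) /\ y <> 0%C /\ sderiv f y (branch_deriv p q a y (f y)).
Proof.
  intros Hq [D [Dx [HD [Hdiff [_ Hcorr]]]]] Hx.
  apply HD, locally_Cmod in Dx. destruct Dx as [d [Hd HDx]].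
  apply Cmod_gt_0 in Hx.
  exists (Rmin d (Cmod x)). split; [apply Rmin_pos; auto|]. intros y Hy.
  generalize (Rmin_l d (Cmod x)) (Rmin_r d (Cmod x)). intros Hl Hr.
  assert (Dy : D y) by (apply HDx; lra).
  assert (Hy0 : y <> 0%C).
  { intros ->. rewrite Cmod_sub_sym in Hy. replace (x - 0)%C with x in Hy by ring. lra. }
  split; auto. split; auto.
  assert (Hn := corr_neq _ _ _ _ _ Hq (Hcorr y Dy) Hy0).
  unfold branch_deriv.
  apply (sderiv_implicit (fun w => w ^ p)%C (fun u => (u - a) ^ q)%C f y _ _ (d - Cmod (y - x))).
  - apply cont_at_ex_derive. auto.
  - lra.
  - intros w Hw. apply Hcorr, HDx. assert (T := Cmod_sub_triangle y w x). lra.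
  - apply sderiv_pow.
  - assert (D1 := sderiv_plus _ _ _ _ _ (sderiv_id (f y)) (sderiv_const (- a)%C (f y))).
    assert (D2 := sderiv_comp _ _ _ _ _ D1 (sderiv_pow q (f y + - a)%C)).
    unfold Cminus. replace (INR q * (f y + - a) ^ (q - 1))%C with
      (INR q * (f y + - a) ^ (q - 1) * (1 + 0))%C by ring. exact D2.
  - apply Cmult_neq_0; [now apply RtoC_INR_neq_0|now apply Cpow_nz].
Qed.

Definition good_branch (p q : nat) (c : C) (F : C -> C) (y : C) : Prop :=
  corr p q c y (F y) /\ y <> 0%C /\ sderiv F y (branch_deriv p q c y (F y)) /\
  (filled_julia p q c y <-> filled_julia p q c (F y)).

(** For [z] near [x] and [c] near [a], [f z + (c - a)] is the only image of [z]
    which can have a bounded orbit. *)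
Lemma good_branch_near (p q : nat) (a x : C) (f : C -> C) :
  (0 < q)%nat -> (q < p)%nat -> univalent_branch_near p q a x f -> x <> 0%C ->
  (forall w, corr p q a x w -> filled_julia p q a w -> w = f x) ->
  exists d, 0 < d /\ forall c y, Cmod (c - a) < d -> Cmod (y - x) < d ->
    good_branch p q c (fun w => f w + (c - a))%C y.
Proof.
  intros Hq Hpq Hf Hx Hu.
  destruct (branch_near_sderiv _ _ _ _ _ Hq Hf Hx) as [d1 [Hd1 H1]].
  destruct (H1 x) as [Hc0 [_ HS0]]; [rewrite Cmod_sub_diag; auto|].
  assert (Hn := corr_neq _ _ _ _ _ Hq Hc0 Hx).
  destruct (corr_locally_unique p q _ Hq Hn) as [eta [Heta Hloc]].
  destruct (sderiv_cont _ _ _ HS0 eta Heta) as [d2 [Hd2 H2]].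
  (* The extra [1] gives an escape radius common to all [c] with [Cmod (c - a) <= 1]. *)
  destruct (image_close p q (3 ^ q + Cmod a + 1) a x (f x) (eta / 2) Hu) as [d3 [Hd3 H3]]; [lra|].
  set (d := Rmin (Rmin d1 d2) (Rmin (Rmin d3 1) (eta / 2))).
  assert (Hd : 0 < d) by (repeat apply Rmin_pos; lra).
  assert (L1 : d <= d1) by (eapply Rle_trans; [apply Rmin_l|apply Rmin_l]).
  assert (L2 : d <= d2) by (eapply Rle_trans; [apply Rmin_l|apply Rmin_r]).
  assert (L3 : d <= Rmin d3 1) by (eapply Rle_trans; [apply Rmin_r|apply Rmin_l]).
  assert (L4 : d <= eta / 2) by (eapply Rle_trans; [apply Rmin_r|apply Rmin_r]).
  assert (L5 : Rmin d3 1 <= d3) by apply Rmin_l.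
  assert (L6 : Rmin d3 1 <= 1) by apply Rmin_r.
  exists d. split; auto. intros c y Hc Hy.
  destruct (H1 y) as [B1 [B2 B3]]; [lra|].
  assert (Ec : (f y + (c - a) - c)%C = (f y - a)%C) by ring.
  assert (B4 : corr p q c y (f y + (c - a))) by (unfold corr; rewrite Ec; exact B1).
  split; auto. split; auto. split.
  - unfold branch_deriv. rewrite Ec.
    assert (D := sderiv_plus _ _ _ _ _ B3 (sderiv_const (c - a)%C y)).
    replace (branch_deriv p q a y (f y) + 0)%C with (branch_deriv p q a y (f y)) in D by ring.
    exact D.
  - split; [|apply filled_julia_backward; auto].
    intros Hk. destruct (filled_julia_forward _ _ _ _ Hk) as [w [Hw1 Hw2]].
    replace (f y + (c - a))%C with w; auto.
    apply (Hloc c y); auto.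
    + replace (w - c - (f x - a))%C with (w - f x - (c - a))%C by ring.
      eapply Rle_lt_trans; [apply Cmod_sub_le|].
      assert (Cmod (w - f x) < eta / 2); [|lra].
      apply (H3 c y); auto; try lra.
      intros N. apply filled_julia_pseudo_orbit; auto; [|lra].
      assert (E := Cmod_le_sub c a). lra.
    + rewrite Ec. replace (f y - a - (f x - a))%C with (f y - f x)%C by ring. apply H2. lra.
Qed.

(** Serves both the return map and the transit from any point of the continued orbit to the
    cycle. *)
Lemma good_branch_chain (p q : nat) (c : C) (F : nat -> C -> C) (zc : nat -> C) (m k : nat) :
  (0 < p)%nat -> (0 < q)%nat ->
  (forall i, zc (S i) = F (S i) (zc i)) ->
  (forall i, (m <= i < m + k)%nat ->
     exists d, 0 < d /\ forall y, Cmod (y - zc i) < d -> good_branch p q c (F (S i)) y) ->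
  compose_from F m k (zc m) = zc (m + k)%nat /\
  sderiv (compose_from F m k) (zc m) (chain_deriv p q c zc m k) /\
  chain_deriv p q c zc m k <> 0%C /\
  exists d, 0 < d /\ forall y, Cmod (y - zc m) < d ->
    (filled_julia p q c y <-> filled_julia p q c (compose_from F m k y)).
Proof.
  intros Hp Hq Hz. induction k as [|k IH]; intros HG.
  - split; [simpl; f_equal; lia|]. split; [apply sderiv_id|].
    split. { simpl. intros E. apply RtoC_inj in E. lra. }
    exists 1. split; [lra|]. tauto.
  - destruct IH as [E1 [E2 [E3 [d1 [Hd1 E4]]]]]. { intros i Hi. apply HG. lia. }
    destruct (HG (m + k)%nat) as [d2 [Hd2 H2]]; [lia|].
    destruct (H2 (zc (m + k)%nat)) as [G1 [G2 [G3 G4]]]; [rewrite Cmod_sub_diag; auto|].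
    rewrite <- Hz in *. simpl compose_from. rewrite Nat.add_succ_r. rewrite E1.
    split; [auto|]. split; [|split].
    + simpl chain_deriv. apply (sderiv_comp (compose_from F m k) (F (S (m + k)))); auto.
      rewrite E1. auto.
    + apply Cmult_neq_0; auto. apply branch_deriv_neq_0; auto.
    + destruct (sderiv_cont _ _ _ E2 d2 Hd2) as [d3 [Hd3 H3]].
      exists (Rmin d1 d3). split; [apply Rmin_pos; auto|]. intros y Hy.
      generalize (Rmin_l d1 d3) (Rmin_r d1 d3). intros.
      rewrite E4 by lra. apply H2. rewrite <- E1. apply H3. lra.
Qed.

Lemma continued_orbit_S (a : C) (f : nat -> C -> C) (xi : C -> C) (c : C) (j : nat) :
  continued_orbit a f xi c (S j) = (f (S j) (continued_orbit a f xi c j) + (c - a))%C.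
Proof. reflexivity. Qed.

(** The fixed point equation closes the orbit at index [l]; the [n]-periodic choice of branches
    propagates this to later indices. *)
Lemma continued_orbit_periodic (a : C) (f : nat -> C -> C) (l n : nat) (zl xi : C -> C) (c : C) :
  (forall (j : nat) (w : C), (l < j)%nat -> f (j + n)%nat w = f j w) ->
  return_map a f l n c (zl c) = zl c -> transit_map a f l c (xi c) = zl c ->
  forall j, (l <= j)%nat -> continued_orbit a f xi c (j + n) = continued_orbit a f xi c j.
Proof.
  intros Hf Hr Ht.
  assert (E : forall i, continued_orbit a f xi c (l + i + n) = continued_orbit a f xi c (l + i)).
  { induction i as [|i IH].
    - rewrite Nat.add_0_r. unfold continued_orbit. rewrite compose_from_add. simpl.
      unfold transit_map, return_map in *. now rewrite Ht.
    - replace (l + S i + n)%nat with (S (l + i + n)) by lia.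
      rewrite Nat.add_succ_r, !continued_orbit_S, IH.
      f_equal. apply (Hf (S (l + i))). lia. }
  intros j Hj. replace j with (l + (j - l))%nat by lia. apply E.
Qed.

(** Successors are matched too, so facts about one step of the orbit need checking only below
    [l + n]. *)
Lemma periodic_reduce (z : nat -> C) (l n : nat) :
  (0 < n)%nat -> (forall j, (l <= j)%nat -> z (j + n)%nat = z j) ->
  forall j, exists i, (i < l + n)%nat /\ z j = z i /\ z (S j) = z (S i).
Proof.
  intros Hn Hz j. induction j as [j IH] using Wf_nat.lt_wf_ind.
  destruct (Nat.lt_ge_cases j (l + n)) as [h|h]; [now exists j|].
  destruct (IH (j - n)%nat) as [i [Hi [E1 E2]]]; [lia|].
  exists i. split; auto. rewrite <- E1, <- E2. split.
  - replace j with (j - n + n)%nat at 1 by lia. apply Hz. lia.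
  - replace (S j) with (S (j - n) + n)%nat by lia. apply Hz. lia.
Qed.

Open Scope C_scope.

Theorem theorem1p1 (p q : nat) (a : C) (z : nat -> C) (l n : nat)
    (f : nat -> C -> C) (zl xi : C -> C) :
  (0 < q)%nat -> (q < p)%nat ->
  misiurewicz p q a ->
  bounded_forward_orbit p q a a z ->
  first_cyclic_index z l ->
  period_from z l n ->
  (forall j : nat,
      univalent_branch_near p q a (z j) (f (S j)) /\ f (S j) (z j) = z (S j)) ->
  (forall (j : nat) (w : C), (l < j)%nat -> f (j + n)%nat w = f j w) ->
  holomorphic_near a zl -> zl a = z l ->
  locally a (fun c => return_map a f l n c (zl c) = zl c) ->
  holomorphic_near a xi -> xi a = a ->
  locally a (fun c => transit_map a f l c (xi c) = zl c) ->
  locally a (fun c => forall j : nat,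
      asymptotically_self_similar (multiplier a f l n zl c)
        (filled_julia p q c) (continued_orbit a f xi c j)).
Proof.
  intros Hq Hpq Hmis Hz _ [Hn [Hper _]] Hbr Hff _ _ Hret Hxi Hxia Htr.
  assert (Hp : (0 < p)%nat) by lia.
  destruct (misiurewicz_orbit p q a z Hp Hq Hmis Hz) as [Hne Huniq].
  assert (Hcorr : forall i, corr p q a (z i) (z (S i))) by apply Hz.
  set (M := (l + n)%nat).
  assert (Hfin := periodic_reduce z l n Hn Hper). fold M in Hfin.
  destruct (orbit_trapping p q a z M Hq Hpq Hz Hne Huniq Hfin) as [U [r [e HT]]].
  assert (Hrep := cycle_repelling p q a z U r e M l n HT Hn (Hper l (le_n _))).
  set (zc := continued_orbit a f xi).
  assert (Hzca : forall j, zc a j = z j).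
  { induction j as [|j IH].
    - unfold zc, continued_orbit. simpl. rewrite Hxia. symmetry. apply Hz.
    - unfold zc in *. rewrite continued_orbit_S, IH, (proj2 (Hbr j)). ring. }
  assert (Hgood : forall j, exists d, (0 < d)%R /\ forall c y, (Cmod (c - a) < d)%R ->
     (Cmod (y - z j) < d)%R -> good_branch p q c (fun w => f (S j) w + (c - a)) y).
  { intros j. destruct (Hbr j) as [Hb E]. apply good_branch_near; auto.
    intros w. rewrite E. apply Huniq. }
  (* Continuity at [a] alone is the aim: it keeps finitely many points close to the [z j] and the
     multiplier outside the closed unit disc. *)
  assert (Hcont : forall j, cont_at (fun c => zc c j) a).
  { induction j as [|j IH].
    - apply (cont_at_ex_derive xi). apply locally_Cmod in Hxi. destruct Hxi as [d [Hd H]].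
      apply H. rewrite Cmod_sub_diag. auto.
    - apply (cont_at_plus (fun c => f (S j) (zc c j)) (fun c => c - a)).
      + apply cont_at_comp; auto. rewrite Hzca.
        destruct (Hgood j) as [d [Hd H]].
        destruct (H a (z j)) as [_ [_ [HS _]]]; try (rewrite Cmod_sub_diag; auto).
        intros e' He'. destruct (sderiv_cont _ _ _ HS e' He') as [d' [Hd' H']].
        exists d'. split; auto. intros y Hy. specialize (H' y Hy). simpl in H'.
        replace (f (S j) y - f (S j) (z j)) with
          (f (S j) y + (a - a) - (f (S j) (z j) + (a - a))) by ring. exact H'.
      + apply (cont_at_plus (fun c => c) (fun _ => - a)); [apply cont_at_id|apply cont_at_const]. }
  assert (Hmult : cont_at (fun c => chain_deriv p q c (zc c) l n) a).
  { generalize n. intros k. induction k as [|k IH].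
    - apply (cont_at_const 1 a).
    - simpl. apply cont_at_mult; auto.
      apply (cont_at_branch_deriv p q a (fun c => zc c (l + k)%nat) (fun c => zc c (S (l + k)))); auto.
      rewrite Hzca. apply (corr_neq p q a (z (l + k)%nat)); auto. }
  rewrite <- (chain_deriv_ext p q a (zc a) z l n Hzca) in Hrep.
  destruct (Hmult (Cmod (chain_deriv p q a (zc a) l n) - 1)%R) as [d1 [Hd1 Hlam]]; [lra|].
  destruct (finite_min (fun j d => forall c y, (Cmod (c - a) < d)%R ->
     (Cmod (y - z j) < d)%R -> good_branch p q c (fun w => f (S j) w + (c - a)) y) M)
    as [d2 [Hd2 Hgoodu]].
  { intros j d d' Hd H c y Hc Hy. apply H; lra. }
  { intros j _. apply Hgood. }
  (* Half of [d2] for the displacement of the orbit point leaves a disc of radius [d2 / 2] around it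
     on which the branch is good. *)
  destruct (finite_min (fun j d => forall c, (Cmod (c - a) < d)%R ->
     (Cmod (zc c j - z j) < d2 / 2)%R) M) as [d3 [Hd3 Hclose]].
  { intros j d d' Hd H c Hc. apply H; lra. }
  { intros j _. destruct (Hcont j (d2 / 2)%R) as [d [Hd H]]; [lra|].
    exists d. split; auto. intros c Hc. rewrite <- (Hzca j). auto. }
  apply locally_Cmod in Hret. destruct Hret as [d4 [Hd4 Hret]].
  apply locally_Cmod in Htr. destruct Htr as [d5 [Hd5 Htr]].
  apply locally_Cmod.
  exists (Rmin (Rmin d1 d2) (Rmin d3 (Rmin d4 d5))). split; [repeat apply Rmin_pos; auto|].
  intros c Hc. apply Rmin_Rgt_l in Hc. destruct Hc as [Hc Hc'].
  apply Rmin_Rgt_l in Hc. destruct Hc as [Hc1 Hc2].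
  apply Rmin_Rgt_l in Hc'. destruct Hc' as [Hc3 Hc'].
  apply Rmin_Rgt_l in Hc'. destruct Hc' as [Hc4 Hc5].
  specialize (Hret c Hc4). specialize (Htr c Hc5).
  assert (Hzper := continued_orbit_periodic a f l n zl xi c Hff Hret Htr).
  assert (Hzred := periodic_reduce (continued_orbit a f xi c) l n Hn Hzper).
  fold zc in Hzper, Hzred. fold M in Hzred.
  set (F := perturb a f c).
  assert (HF : forall i, zc c (S i) = F (S i) (zc c i)) by reflexivity.
  assert (Hg : forall i, (i < M)%nat -> exists d, (0 < d)%R /\ forall y, (Cmod (y - zc c i) < d)%R ->
     good_branch p q c (F (S i)) y).
  { intros i Hi. exists (d2 / 2)%R. split; [lra|]. intros y Hy.
    apply (Hgoodu i Hi c y Hc2). specialize (Hclose i Hi c Hc3).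
    eapply Rle_lt_trans; [apply (Cmod_sub_triangle (zc c i))|]. lra. }
  assert (Hgz : forall i, (i < M)%nat -> good_branch p q c (F (S i)) (zc c i)).
  { intros i Hi. destruct (Hg i Hi) as [d [Hd H]]. apply H. rewrite Cmod_sub_diag. auto. }
  assert (Horb : forall i, corr p q c (zc c i) (zc c (S i))).
  { intros i. destruct (Hzred i) as [i' [Hi' [E1 E2]]]. rewrite E1, E2, HF. apply Hgz. auto. }
  assert (HKz : forall j, filled_julia p q c (zc c j)).
  { intros j. exists (fun i => zc c (j + i)%nat). split; [f_equal; lia|]. split.
    - intros i. replace (j + S i)%nat with (S (j + i)) by lia. apply Horb.
    - apply bounded_seq_iff. exists (r + d2)%R. intros i.
      destruct (Hzred (j + i)%nat) as [i' [Hi' [E _]]]. rewrite E.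
      assert (B1 := Hclose i' Hi' c Hc3). assert (B2 := Cmod_le_sub (zc c i') (z i')).
      assert (B3 := trap_bounded _ _ _ _ _ _ _ _ HT _ (trap_in _ _ _ _ _ _ _ _ HT i')). lra. }
  assert (Ezl : zl c = zc c l) by (symmetry; exact Htr).
  destruct (good_branch_chain p q c F (zc c) l n Hp Hq HF) as [R1 [R2 [_ R4]]].
  { intros i Hi. apply Hg. unfold M. lia. }
  rewrite Hzper in R1 by lia.
  assert (El : multiplier a f l n zl c = chain_deriv p q c (zc c) l n).
  { unfold multiplier. rewrite Ezl. apply sderiv_is_derive. exact R2. }
  rewrite El. intros j. destruct (Hzred j) as [i [Hi [E _]]].
  change (continued_orbit a f xi c j) with (zc c j). rewrite E.
  (* Running up to index [l + n], where the orbit is again at [z_l(c)], treats points before the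
     cycle and on it alike. *)
  destruct (good_branch_chain p q c F (zc c) i (M - i) Hp Hq HF) as [T1 [T2 [T3 T4]]].
  { intros i' Hi'. apply Hg. lia. }
  replace (i + (M - i))%nat with (l + n)%nat in T1 by (unfold M in *; lia).
  rewrite Hzper in T1 by lia.
  apply (self_similar_of_repelling _ (zc c l) _ _ (chain_deriv p q c (zc c) i (M - i))
           (compose_from F l n) (compose_from F i (M - i))); auto.
  - apply closed_filled_julia; auto.
  - specialize (Hlam c Hc1). rewrite Cmod_sub_sym in Hlam.
    assert (B := Cmod_le_sub (chain_deriv p q a (zc a) l n) (chain_deriv p q c (zc c) l n)). lra.
Qed.
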